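(* Let $m,n\ge 1$, $\mathbb{A}=(A_1,\dots,A_n)\in\mathbb{P}_m^n$ and $\omega=(w_1,\dots,w_n)\in\Delta_n$. For $0 < t \leq z < 1$, $$\Vert P_{1-t}(\omega; \mathbb{A}) \Vert \leq \Vert \Omega_{t,z}(\omega; \mathbb{A}) \Vert \leq \Vert \mathcal{Q}_{\frac{1-t}{z}}(\omega;\mathbb{A}) \Vert.$$ Furthermore, $\Vert \mathcal{Q}_{\frac{t-1}{z}}(\omega;\mathbb{A}) \Vert \leq \Vert \Omega_{t,z}(\omega; \mathbb{A}) \Vert$.
   Context: $\mathbb{P}_m$ is the set of $m\times m$ complex Hermitian positive definite matrices. $\Delta_n$ is the set of positive probability vectors $\omega=(w_1,\dots,w_n)$, i.e. $w_j>0$ and $\sum_j w_j=1$. $\Vert\cdot\Vert$ is the operator norm. Quasi-arithmetic mean of order $r\ne 0$: $\mathcal{Q}_r(\omega;\mathbb{A})=\left(\sum_{j=1}^n w_jA_j^r\right)^{1/r}$. Lim–Pálfia power mean: for $r\in(0,1]$, $P_r(\omega;\mathbb{A})$ is the unique $X\in\mathbb{P}_m$ satisfying $X = \sum_{i=1}^{n} w_{i} (X \#_{r} A_{i})$, where $A \#_{r} B = A^{1/2} (A^{-1/2} B A^{-1/2})^{r} A^{1/2}$. $t$-$z$ Rényi right mean: for $0<t\le z<1$, $\Omega_{t,z}(\omega;\mathbb{A})=\arg\min_{X\in\mathbb{P}_m}\sum_{j=1}^n w_j\Phi_{t,z}(A_j,X)$, where $\Phi_{t,z}(A,B)=\operatorname{tr}((1-t)A+tB)-\operatorname{tr}\left(A^{\frac{1-t}{2z}}B^{\frac{t}{z}}A^{\frac{1-t}{2z}}\right)^z$.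 It is known that this minimizer exists and is unique, and that it coincides with the unique $X\in\mathbb{P}_m$ satisfying $X=\sum_{j=1}^n w_j\left(X^{\frac{t}{2z}}A_j^{\frac{1-t}{z}}X^{\frac{t}{2z}}\right)^z$. *)

(* Defs.v *)
From mathcomp Require Import all_boot all_order all_algebra complex spectral.
From mathcomp Require Import all_classical all_reals all_analysis.

Set Implicit Arguments.
Unset Strict Implicit.
Unset Printing Implicit Defensive.

Import Order.TTheory GRing.Theory Num.Theory.
Local Open Scope ring_scope.
Local Open Scope complex_scope.
Local Open Scope sesquilinear_scope.
Local Open Scope classical_set_scope.

Section MatrixMeans.
Variable R : realType.

(* The order of R[i] is partial: 0 < z means that z is real and positive. *)
Definition posdefmx m (A : 'M[R[i]]_m) : Prop :=
  A \is hermsymmx /\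
  forall x : 'cV[R[i]]_m, x != 0 -> 0 < (x^t* *m A *m x) 0 0.

(* The power is only meaningful for positive definite A, whose spectral_diag is
   real and positive; the result then does not depend on the diagonalization
   A = P^-1 *m diag_mx d *m P selected by spectralmx and spectral_diag. *)
Definition mxpowR m (A : 'M[R[i]]_m) (r : R) : 'M[R[i]]_m :=
  invmx (spectralmx A)
    *m diag_mx (map_mx (fun z : R[i] => (powR (complex.Re z) r)%:C)
                       (spectral_diag A))
    *m spectralmx A.

Definition vecnorm m (x : 'cV[R[i]]_m) : R :=
  Num.sqrt (\sum_i Normc.normc (x i 0) ^+ 2).

Definition opnorm m (A : 'M[R[i]]_m) : R :=
  sup [set vecnorm (A *m x) | x in [set x : 'cV[R[i]]_m | vecnorm x <= 1]].

Definition prob_vector n (w : 'I_n -> R) : Prop :=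
  (forall j, 0 < w j) /\ \sum_j w j = 1.

Definition quasi_mean m n (r : R) (w : 'I_n -> R) (A : 'I_n -> 'M[R[i]]_m) :
    'M[R[i]]_m :=
  mxpowR (\sum_j (w j)%:C *: mxpowR (A j) r) r^-1.

Definition geomean m (r : R) (A B : 'M[R[i]]_m) : 'M[R[i]]_m :=
  mxpowR A (1 / 2)
    *m mxpowR (mxpowR A (- (1 / 2)) *m B *m mxpowR A (- (1 / 2))) r
    *m mxpowR A (1 / 2).

Definition is_power_mean m n (r : R) (w : 'I_n -> R)
    (A : 'I_n -> 'M[R[i]]_m) (X : 'M[R[i]]_m) : Prop :=
  posdefmx X /\ X = \sum_i (w i)%:C *: geomean r X (A i).

(* Both traces are real for positive definite A and B; complex.Re only casts
   them to R. *)
Definition renyi_div m (t z : R) (A B : 'M[R[i]]_m) : R :=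
  complex.Re (\tr ((1 - t)%:C *: A + t%:C *: B))
  - complex.Re (\tr (mxpowR (mxpowR A ((1 - t) / (2 * z))
                               *m mxpowR B (t / z)
                               *m mxpowR A ((1 - t) / (2 * z))) z)).

Definition renyi_objective m n (t z : R) (w : 'I_n -> R)
    (A : 'I_n -> 'M[R[i]]_m) (X : 'M[R[i]]_m) : R :=
  \sum_j w j * renyi_div t z (A j) X.

Definition is_renyi_right_mean m n (t z : R) (w : 'I_n -> R)
    (A : 'I_n -> 'M[R[i]]_m) (X : 'M[R[i]]_m) : Prop :=
  posdefmx X /\
  forall Y, posdefmx Y -> renyi_objective t z w A X <= renyi_objective t z w A Y.

End MatrixMeans.

(* Main.v *)
From HB Require Import structures.
Require Import Defs.
From mathcomp Require Import all_boot all_order all_algebra complex spectral.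
From mathcomp Require Import all_classical all_reals all_analysis.
From mathcomp Require Import ring lra.

(** Write X for the minimizer Omega, s = t / z and p = (1 - t) / z, so that
    (s + p) z = 1.

    The substitution Z = X^s turns the objective, up to a constant, into
    t tr Z^(1/s) - sum_j w_j tr (A_j^(p/2) Z A_j^(p/2))^z.  Matrix powers need
    not be differentiated: writing traces of functions of two Hermitian matrices
    in their two eigenbases reduces first order expansions with quadratic
    remainder to scalar ones ([tr_quad_le]), and letting the perturbation of Z
    tend to 0 yields the fixed-point equation
    X = sum_j w_j (X^(s/2) A_j^p X^(s/2))^z ([renyi_min_fixed]).

    All order arguments rest on one inequality ([operator_jensen]): if
    sum_j w_j K_j^* K_j <= 1 and sum_j w_j K_j^* Y_j K_j <= D, then
    sum_j w_j K_j^* Y_j^r K_j <= D^r for 0 <= r <= 1.  It contains the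
    Loewner-Heinz inequality, Hansen's inequality and the operator concavity of
    the power r.  The exponents r for which it holds form a closed set that
    contains 0 and 1 and is stable under midpoints.

    Let l be the norm of X.
    - Upper bound.  With S = sum_j w_j A_j^p, concavity gives
      X <= (X^(s/2) S X^(s/2))^z, hence l <= l^t |S|^z, that is
      l^(1-t) <= |S|^z.
    - Lower bound by the quasi-arithmetic mean of order -p.  With
      N = sum_j w_j A_j^(-p) and D = X^(-s/2) N X^(-s/2), concavity and the
      arithmetic-harmonic inequality give X^(-1) <= D^z.  Loewner-Heinz turns
      this into X^(-s) <= D^t, and D >= l^(-1/z) gives D >= l^(-p) D^t.
      Together N >= l^(-p).
    - Lower bound by the power mean.  By homogeneity suppose X <= 1 and put
      V = X^(1-s) <= X^(-s).  The fixed-point equation says that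
      sum_j w_j X^(-s) #_z A_j^p = V.  Hansen's inequality when p >= 1, and an
      Ando-Hiai type inequality when p <= 1, convert this into
      sum_j w_j V #_(1-t) A_j <= V.  The map defining the power mean is monotone
      and homogeneous of degree t < 1, so such a V dominates its fixed point:
      P <= V <= 1. *)

Import Order.TTheory GRing.Theory Num.Theory.
Local Open Scope ring_scope.
Local Open Scope sesquilinear_scope.

Set Implicit Arguments.
Unset Strict Implicit.
Unset Printing Implicit Defensive.

(** * Complex scalars, adjoints and the Loewner order *)

(** The complex numbers over R, known only through the real scalars and the real
    part: an abstract field keeps conversion from computing with pairs of reals in
    every comparison of matrices.  The concrete field is [Rcx]. *)
Record cplx (R : realType) := Cplx {
  csort :> numClosedFieldType;
  rc : {rmorphism R -> csort};
  re : csort -> R;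
  rcK : cancel rc re;
  reK : {in Num.real, cancel re rc};
  le_rc : {mono rc : x y / x <= y}
}.

Definition adj (C : numClosedFieldType) m n (A : 'M[C]_(m, n)) : 'M[C]_(n, m) := A^t*.

(** The matrix with orthonormal eigenvectors the columns of U^* and eigenvalues a,
    when U is unitary. *)
HB.lock Definition spec (R : realType) (C : cplx R) m (U : 'M[C]_m) (a : 'I_m -> R) : 'M[C]_m :=
  adj U *m diag_mx (\row_i rc C (a i)) *m U.

(** The real power of a positive definite matrix; by [mpow_spec] any
    diagonalization computes it. *)
HB.lock Definition mpow (R : realType) (C : cplx R) m (A : 'M[C]_m) (r : R) : 'M[C]_m :=
  invmx (spectralmx A)
    *m diag_mx (map_mx (fun z : C => rc C (powR (re z) r)) (spectral_diag A))
    *m spectralmx A.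

Section Loewner.
Context {R : realType} {C : cplx R}.
Local Notation rc := (@rc R C).
Local Notation re := (@re R C).

Lemma rc_ge0 x : (0 <= rc x) = (0 <= x).
Proof. by rewrite -(rmorph0 rc) le_rc. Qed.

Lemma rc_inj : injective rc.
Proof. exact: can_inj (@rcK R C). Qed.

Lemma lt_rc : {mono rc : x y / x < y}.
Proof. by move=> x y; rewrite !lt_neqAle le_rc (inj_eq rc_inj). Qed.

Lemma rc_gt0 x : (0 < rc x) = (0 < x).
Proof. by rewrite -(rmorph0 rc) lt_rc. Qed.

Lemma rc_real x : rc x \is Num.real.
Proof. by rewrite realE rc_ge0 -(rmorph0 rc) le_rc; exact: le_total. Qed.

Lemma conj_rc x : (rc x)^* = rc x.
Proof. exact/CrealP/rc_real. Qed.

Lemma adjK m n (A : 'M[C]_(m, n)) : adj (adj A) = A.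
Proof. exact: trmxCK. Qed.

Lemma adjM m n p (A : 'M[C]_(m, n)) (B : 'M[C]_(n, p)) :
  adj (A *m B) = adj B *m adj A.
Proof. by rewrite /adj trmx_mul map_mxM. Qed.

Lemma adjD m n (A B : 'M[C]_(m, n)) : adj (A + B) = adj A + adj B.
Proof. by rewrite /adj linearD map_mxD. Qed.

Lemma adjB m n (A B : 'M[C]_(m, n)) : adj (A - B) = adj A - adj B.
Proof. by rewrite /adj linearB map_mxB. Qed.

Lemma adjZ m n (c : R) (A : 'M[C]_(m, n)) : adj (rc c *: A) = rc c *: adj A.
Proof. by apply/matrixP => i j; rewrite !mxE rmorphM /= conj_rc. Qed.

Lemma adj1 m : adj (1%:M : 'M[C]_m) = 1%:M.
Proof. by rewrite /adj trmx1 map_mx1. Qed.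

Lemma adj_sum m n (I : finType) (F : I -> 'M[C]_(m, n)) :
  adj (\sum_i F i) = \sum_i adj (F i).
Proof.
apply/matrixP => i j; rewrite !(mxE, summxE) rmorph_sum.
by apply: eq_bigr => k _; rewrite !mxE.
Qed.

Lemma hermE m (A : 'M[C]_m) : A \is hermsymmx <-> adj A = A.
Proof.
by split=> [/is_hermitianmxP|h]; [|apply/is_hermitianmxP]; rewrite expr0 scale1r.
Qed.

Definition unitary m (U : 'M[C]_m) : Prop := adj U *m U = 1%:M.

Lemma unitaryP m (U : 'M[C]_m) : U \is unitarymx -> unitary U.
Proof. by move=> Uu; rewrite /unitary /adj -invmx_unitary// mulVmx// unitarymx_unit. Qed.

Lemma unitary_inv m (U : 'M[C]_m) : unitary U -> invmx U = adj U.
Proof.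
move=> uU; have /mulmx1_unit[_ Uu] := uU.
by rewrite -[LHS]mul1mx -uU -mulmxA mulmxV ?mulmx1.
Qed.

Definition qform m (A : 'M[C]_m) (x : 'cV[C]_m) : C := (adj x *m A *m x) 0 0.

Lemma qformB m (A B : 'M[C]_m) x : qform (A - B) x = qform A x - qform B x.
Proof. by rewrite /qform mulmxBr mulmxBl !mxE. Qed.

Lemma qformZ m c (A : 'M[C]_m) x : qform (c *: A) x = c * qform A x.
Proof. by rewrite /qform -scalemxAr -scalemxAl mxE. Qed.

Lemma qform_sum m (I : finType) (F : I -> 'M[C]_m) x :
  qform (\sum_i F i) x = \sum_i qform (F i) x.
Proof. by rewrite /qform mulmx_sumr mulmx_suml summxE. Qed.

Lemma qform_congr m (A T : 'M[C]_m) x : qform (adj T *m A *m T) x = qform A (T *m x).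
Proof. by rewrite /qform adjM !mulmxA. Qed.

(** The Loewner order.  Since the order of C is partial, the comparison also says that
    the quadratic form of B - A is real, that is, that B - A is Hermitian. *)
Definition lemx m (A B : 'M[C]_m) : Prop := forall x, qform A x <= qform B x.
Local Notation "A <=L B" := (lemx A B) (at level 70).

Lemma lemx_refl m (A : 'M[C]_m) : A <=L A.
Proof. by []. Qed.

Lemma lemx_trans m (B A D : 'M[C]_m) : A <=L B -> B <=L D -> A <=L D.
Proof. by move=> AB BD x; apply: le_trans (AB x) (BD x). Qed.

Lemma lemxZ m (c : R) (A B : 'M[C]_m) : 0 <= c -> A <=L B -> rc c *: A <=L rc c *: B.
Proof. by move=> c0 AB x; rewrite !qformZ ler_wpM2l// rc_ge0. Qed.

Lemma lemx_sum m (I : finType) (F G : I -> 'M[C]_m) :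
  (forall i, F i <=L G i) -> \sum_i F i <=L \sum_i G i.
Proof. by move=> FG x; rewrite !qform_sum; apply: ler_sum => i _; apply: FG. Qed.

Lemma lemx_congr m (T A B : 'M[C]_m) : A <=L B ->
  adj T *m A *m T <=L adj T *m B *m T.
Proof. by move=> AB x; rewrite !qform_congr. Qed.

Lemma specE m (U : 'M[C]_m) a :
  spec U a = adj U *m diag_mx (\row_i rc (a i)) *m U.
Proof. by rewrite unlock. Qed.

(** * Spectral calculus *)

Section Unitary.
Context {m : nat} {U : 'M[C]_m} (Uu : unitary U).

Lemma unitaryl : adj U *m U = 1%:M.
Proof. exact: Uu. Qed.

Lemma unitaryr : U *m adj U = 1%:M.
Proof. exact: mulmx1C. Qed.

Lemma specM a b : spec U a *m spec U b = spec U (fun i => a i * b i).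
Proof.
rewrite !specE !mulmxA -(mulmxA _ U) unitaryr mulmx1 -(mulmxA (adj U)) mulmx_diag.
congr (_ *m diag_mx _ *m _); apply/rowP => i; rewrite !mxE.
by rewrite rmorphM.
Qed.

Lemma mulmx_spec a : U *m spec U a = diag_mx (\row_i rc (a i)) *m U.
Proof. by rewrite !specE !mulmxA unitaryr mul1mx. Qed.

Lemma spec_mulmx a : spec U a *m adj U = adj U *m diag_mx (\row_i rc (a i)).
Proof. by rewrite !specE -mulmxA unitaryr mulmx1. Qed.

Lemma spec_const c : spec U (fun=> c) = (rc c)%:M.
Proof.
rewrite !specE (_ : \row_i _ = const_mx (rc c)); last by apply/rowP => i; rewrite !mxE.
by rewrite diag_const_mx mul_mx_scalar -scalemxAl unitaryl scalemx1.
Qed.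

Lemma spec1 : spec U (fun=> 1) = 1%:M.
Proof. by rewrite spec_const rmorph1. Qed.

End Unitary.

Lemma specZ m (U : 'M[C]_m) c a : rc c *: spec U a = spec U (fun i => c * a i).
Proof.
rewrite !specE scalemxAl scalemxAr -linearZ /=; congr (_ *m diag_mx _ *m _).
by apply/rowP => i; rewrite !mxE rmorphM.
Qed.

Lemma eq_spec m (U : 'M[C]_m) a b : a =1 b -> spec U a = spec U b.
Proof.
move=> ab; rewrite !specE; congr (_ *m diag_mx _ *m _).
by apply/rowP => i; rewrite !mxE ab.
Qed.

Lemma adj_spec m (U : 'M[C]_m) a : adj (spec U a) = spec U a.
Proof.
rewrite !specE !adjM adjK mulmxA; congr (_ *m _ *m _); apply/matrixP => i j.
by rewrite !mxE [in LHS]eq_sym; case: eqP => [->|_]; rewrite ?conj_rc ?conjC0.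
Qed.

Lemma qform_diag m (d : 'rV[C]_m) x :
  qform (diag_mx d) x = \sum_i d 0 i * `|x i 0| ^+ 2.
Proof.
rewrite /qform -mulmxA mul_diag_mx mxE; apply: eq_bigr => i _.
by rewrite !mxE mulrCA normCKC.
Qed.

Lemma qform_spec m (U : 'M[C]_m) a x :
  qform (spec U a) x = \sum_i rc (a i) * `|(U *m x) i 0| ^+ 2.
Proof. by rewrite !specE qform_congr qform_diag; apply: eq_bigr => i _; rewrite mxE. Qed.

Lemma le_spec m (U : 'M[C]_m) a b : (forall i, a i <= b i) -> spec U a <=L spec U b.
Proof.
move=> ab x; rewrite !qform_spec; apply: ler_sum => i _.
by rewrite ler_wpM2r ?exprn_ge0// le_rc.
Qed.

Lemma spectral_spec m (A : 'M[C]_m) : adj A = A ->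
  A = spec (spectralmx A) (fun i => re (spectral_diag A 0 i)).
Proof.
move=> /hermE hA; have rA := hermitian_spectral_diag_real hA.
have := hermitian_normalmx hA => /orthomx_spectralP eA.
rewrite !specE (_ : \row_i _ = spectral_diag A).
  by rewrite -unitary_inv; [exact: eA | exact/unitaryP/spectral_unitarymx].
by apply/rowP => i; rewrite mxE reK//; move/mxOverP: rA; apply.
Qed.

Lemma herm_spec m (A : 'M[C]_m) : adj A = A ->
  exists U a, unitary U /\ A = spec U a.
Proof.
move=> /spectral_spec eA; exists (spectralmx A).
by eexists; split; [exact/unitaryP/spectral_unitarymx|exact: eA].
Qed.

Lemma delta_neq0 m (i : 'I_m) : (delta_mx i 0 : 'cV[C]_m) != 0.
Proof. by apply/negP => /eqP/colP/(_ i)/eqP; rewrite !mxE !eqxx oner_eq0. Qed.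

(** Eigenvalues are values of the quadratic form; this is how an inequality between
    matrices yields inequalities between eigenvalues. *)
Lemma qform_spec_eigen m (U : 'M[C]_m) a i : unitary U ->
  qform (spec U a) (adj U *m delta_mx i 0) = rc (a i).
Proof.
move=> Uu; rewrite qform_spec mulmxA unitaryr// mul1mx (bigD1 i)//= big1 => [|j ji].
  by rewrite !mxE !eqxx normr1 expr1n mulr1 addr0.
by rewrite !mxE (negPf ji) normr0 expr0n mulr0.
Qed.

Definition posdef m (A : 'M[C]_m) : Prop :=
  adj A = A /\ (forall x, x != 0 -> 0 < qform A x).

Lemma posdef_spec m (A : 'M[C]_m) : posdef A ->
  exists U a, [/\ unitary U, (forall i, 0 < a i) & A = spec U a].
Proof.
case => /herm_spec [U [a [Uu ->]]] pA; exists U, a; split=> // i.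
have := pA (adj U *m delta_mx i 0); rewrite qform_spec_eigen//.
rewrite rc_gt0; apply; apply/negP => /eqP/(congr1 (mulmx U)).
by rewrite mulmxA unitaryr// mul1mx mulmx0 => /eqP; apply/negP/delta_neq0.
Qed.

Lemma spec_posdef m (U : 'M[C]_m) a : unitary U -> (forall i, 0 < a i) ->
  posdef (spec U a).
Proof.
move=> Uu a0; split=> [|x x0]; first exact: adj_spec.
rewrite qform_spec.
have s0 i : 0 <= rc (a i) * `|(U *m x) i 0| ^+ 2.
  by rewrite mulr_ge0 ?exprn_ge0// rc_ge0 ltW.
rewrite lt_neqAle sumr_ge0// andbT eq_sym; apply/negP => /eqP /psumr_eq0P e.
case/negP: x0; suff Ux0 : U *m x = 0 by rewrite -[x]mul1mx -(unitaryl Uu) -mulmxA Ux0 mulmx0.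
apply/colP => i; have /eqP := e (fun i _ => s0 i) i isT.
have ai : rc (a i) != 0 :> C by rewrite gt_eqF// rc_gt0.
rewrite mulf_eq0 (negPf ai) /= expf_eq0 /= normr_eq0.
by rewrite [RHS]mxE => /eqP.
Qed.

(** With W = V T U^*, the hypothesis reads b_i W_ij = W_ij a_j: either W_ij = 0 or
    b_i = a_j, and both survive the application of f.  With T = 1 this is the
    independence of the functional calculus from the diagonalization. *)
Lemma spec_intertwine m (U V T : 'M[C]_m) a b (f : R -> R) :
  unitary U -> unitary V ->
  spec V b *m T = T *m spec U a ->
  spec V (fun i => f (b i)) *m T = T *m spec U (fun i => f (a i)).
Proof.
move=> Uu Vu e; pose W := V *m T *m adj U.
have key g h : (spec V g *m T = T *m spec U h) <->
    diag_mx (\row_i rc (g i)) *m W = W *m diag_mx (\row_i rc (h i)).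
  split=> E.
    rewrite /W !mulmxA -mulmx_spec// -(mulmxA V) E !mulmxA.
    by rewrite -(mulmxA (V *m T)) spec_mulmx// mulmxA.
  have specVT : adj V *m (diag_mx (\row_i rc (g i)) *m W) *m U = spec V g *m T.
    rewrite /W !mulmxA -(mulmxA (adj V)) -(mulmx_spec Vu) !mulmxA (unitaryl Vu) mul1mx.
    by rewrite -mulmxA (unitaryl Uu) mulmx1.
  rewrite -specVT E /W !mulmxA (unitaryl Vu) mul1mx -(mulmxA T) -(spec_mulmx Uu).
  by rewrite -!mulmxA (unitaryl Uu) mulmx1.
apply/key; move/key: e; clearbody W; move=> /matrixP e; apply/matrixP => i j.
have := e i j; rewrite !mul_diag_mx !mul_mx_diag !mxE => /eqP.
rewrite mulrC -subr_eq0 -mulrBr mulf_eq0 => /orP[/eqP->|]; first by rewrite mulr0 mul0r.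
by rewrite subr_eq0 (inj_eq rc_inj) => /eqP->; rewrite mulrC.
Qed.

Lemma mpow_spec m (U : 'M[C]_m) a r : unitary U ->
  mpow (spec U a) r = spec U (fun i => powR (a i) r).
Proof.
move=> Uu; set A := spec U a; have Vu := unitaryP (spectral_unitarymx A).
pose b i := re (spectral_diag A 0 i).
have AE : A = spec (spectralmx A) b by apply/spectral_spec/adj_spec.
have e1 : spec (spectralmx A) b *m 1%:M = 1%:M *m spec U a.
  by rewrite -AE mulmx1 mul1mx.
have := spec_intertwine (fun x => powR x r) Uu Vu e1.
rewrite mulmx1 mul1mx => <-; rewrite unlock specE -(unitary_inv Vu).
rewrite (_ : map_mx _ _ = \row_i rc (powR (b i) r)); first by [].
by apply/rowP => i; rewrite !mxE.
Qed.

End Loewner.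
Notation "A <=L B" := (lemx A B) (at level 70).

(** * Real powers of positive definite matrices *)

Section Powers.
Context {R : realType} {C : cplx R}.
Local Notation rc := (@rc R C).

Lemma powR_add (x r s : R) : 0 < x -> powR x (r + s) = powR x r * powR x s.
Proof. by move=> x0; rewrite powRD//; apply/implyP => _; rewrite gt_eqF. Qed.

Lemma spec_le m (U : 'M[C]_m) a b : unitary U -> spec U a <=L spec U b ->
  forall i, a i <= b i.
Proof.
move=> Uu ab i; have := ab (adj U *m delta_mx i 0).
by rewrite !(qform_spec_eigen _ _ Uu) le_rc.
Qed.

Section OneMatrix.
Context {m : nat} {A : 'M[C]_m} (pA : posdef A).

Lemma posdef_adj : adj A = A.
Proof. by case: pA. Qed.

Lemma posdef_mpow r : posdef (mpow A r).
Proof.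
have [U [a [Uu a0 ->]]] := posdef_spec pA; rewrite (mpow_spec _ _ Uu).
by apply: spec_posdef => // i; apply: powR_gt0.
Qed.

Lemma adj_mpow r : adj (mpow A r) = mpow A r.
Proof. by case: (posdef_mpow r). Qed.

Lemma mpowD r s : mpow A r *m mpow A s = mpow A (r + s).
Proof.
have [U [a [Uu a0 ->]]] := posdef_spec pA; rewrite !(mpow_spec _ _ Uu) (specM Uu).
by apply: eq_spec => i; rewrite powR_add.
Qed.

Lemma mpowM r s : mpow (mpow A r) s = mpow A (r * s).
Proof.
have [U [a [Uu a0 ->]]] := posdef_spec pA; rewrite !(mpow_spec _ _ Uu).
by apply: eq_spec => i; rewrite powRrM.
Qed.

Lemma mpow0 : mpow A 0 = 1%:M.
Proof.
have [U [a [Uu a0 ->]]] := posdef_spec pA; rewrite !(mpow_spec _ _ Uu).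
by rewrite -(spec1 Uu); apply: eq_spec => i; rewrite powRr0.
Qed.

Lemma mpow1 : mpow A 1 = A.
Proof.
have [U [a [Uu a0 ->]]] := posdef_spec pA; rewrite !(mpow_spec _ _ Uu).
by apply: eq_spec => i; rewrite powRr1// ltW.
Qed.

Lemma mpowK r : mpow A r *m mpow A (- r) = 1%:M.
Proof. by rewrite mpowD subrr mpow0. Qed.

Lemma mpowNK r : mpow A (- r) *m mpow A r = 1%:M.
Proof. by rewrite mpowD addNr mpow0. Qed.

Lemma posdefZ c : 0 < c -> posdef (rc c *: A).
Proof.
have [U [a [Uu a0 ->]]] := posdef_spec pA => c0.
by rewrite specZ; apply: spec_posdef => // i; rewrite mulr_gt0.
Qed.

Lemma mpowZ c r : 0 < c -> mpow (rc c *: A) r = rc (powR c r) *: mpow A r.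
Proof.
have [U [a [Uu a0 ->]]] := posdef_spec pA => c0.
rewrite specZ !(mpow_spec _ _ Uu) specZ; apply: eq_spec => i.
by rewrite powRM// ltW.
Qed.

Lemma posdef_congr (T T' : 'M[C]_m) : T' *m T = 1%:M -> posdef (adj T *m A *m T).
Proof.
move=> TK; have [hA qA] := pA; split=> [|x x0].
  by rewrite !adjM adjK hA mulmxA.
rewrite qform_congr; apply: qA; apply: contra x0 => /eqP Tx.
by rewrite -[x]mul1mx -TK -mulmxA Tx mulmx0.
Qed.

Lemma mpow_le_scalar c r : 0 <= r -> A <=L (rc c)%:M -> mpow A r <=L (rc (powR c r))%:M.
Proof.
have [U [a [Uu a0 ->]]] := posdef_spec pA => r0.
rewrite -!(spec_const Uu) (mpow_spec _ _ Uu) => /(spec_le Uu) ac.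
apply: le_spec => i; apply: ge0_ler_powR => //; rewrite nnegrE ?ltW//.
exact: lt_le_trans (ac i).
Qed.

Lemma mpow_le1 r : 0 <= r -> A <=L 1%:M -> mpow A r <=L 1%:M.
Proof.
by move=> r0; have := @mpow_le_scalar 1 r r0; rewrite powR1 rmorph1.
Qed.

Lemma mpow_ge_scalar c r : 0 < c -> 0 <= r -> (rc c)%:M <=L A ->
  (rc (powR c r))%:M <=L mpow A r.
Proof.
have [U [a [Uu a0 ->]]] := posdef_spec pA => c0 r0.
rewrite -!(spec_const Uu) (mpow_spec _ _ Uu) => /(spec_le Uu) ac.
by apply: le_spec => i; apply: ge0_ler_powR; rewrite ?nnegrE ?(ltW c0) ?(ltW (a0 i)) ?ac.
Qed.

Lemma mpowN_le_scalar c r : 0 < c -> 0 <= r -> (rc c)%:M <=L A ->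
  mpow A (- r) <=L (rc (powR c (- r)))%:M.
Proof.
have [U [a [Uu a0 ->]]] := posdef_spec pA => c0 r0.
rewrite -!(spec_const Uu) (mpow_spec _ _ Uu) => /(spec_le Uu) ac.
apply: le_spec => i; rewrite !powRN lef_pV2 ?posrE ?powR_gt0//.
by apply: ge0_ler_powR; rewrite ?nnegrE ?(ltW c0) ?(ltW (a0 i)) ?ac.
Qed.

Lemma mpowN_ge_scalar c r : 0 < c -> 0 <= r -> A <=L (rc c)%:M ->
  (rc (powR c (- r)))%:M <=L mpow A (- r).
Proof.
have [U [a [Uu a0 ->]]] := posdef_spec pA => c0 r0.
rewrite -!(spec_const Uu) (mpow_spec _ _ Uu) => /(spec_le Uu) ac.
apply: le_spec => i; rewrite !powRN lef_pV2 ?posrE ?powR_gt0//.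
by apply: ge0_ler_powR; rewrite ?nnegrE ?(ltW c0) ?(ltW (a0 i)) ?ac.
Qed.

Lemma mpow_le_expo c r s : 0 < c -> r <= s -> A <=L (rc c)%:M ->
  mpow A s <=L rc (powR c (s - r)) *: mpow A r.
Proof.
have [U [a [Uu a0 ->]]] := posdef_spec pA => c0 rs.
rewrite -(spec_const Uu) !(mpow_spec _ _ Uu) specZ => /(spec_le Uu) ac.
apply: le_spec => i; rewrite -[in leLHS](subrK r s) (powR_add _ _ (a0 i)).
rewrite ler_wpM2r ?powR_ge0//.
by apply: ge0_ler_powR; rewrite ?nnegrE ?subr_ge0 ?(ltW c0) ?(ltW (a0 i)) ?ac.
Qed.

Lemma mpow_ge_expo c r s : 0 < c -> r <= s -> (rc c)%:M <=L A ->
  rc (powR c (s - r)) *: mpow A r <=L mpow A s.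
Proof.
have [U [a [Uu a0 ->]]] := posdef_spec pA => c0 rs.
rewrite -(spec_const Uu) !(mpow_spec _ _ Uu) specZ => /(spec_le Uu) ac.
apply: le_spec => i; rewrite -[in leRHS](subrK r s) (powR_add _ _ (a0 i)).
rewrite ler_wpM2r ?powR_ge0//.
by apply: ge0_ler_powR; rewrite ?nnegrE ?subr_ge0 ?(ltW c0) ?(ltW (a0 i)) ?ac.
Qed.

Lemma posdef_max_eigenvalue : (0 < m)%N -> exists c, [/\ 0 < c, A <=L (rc c)%:M &
  forall d, A <=L (rc d)%:M -> c <= d].
Proof.
have [U [a [Uu a0 ->]]] := posdef_spec pA => m0.
have [i _ ai] := @arg_maxP _ _ _ (Ordinal m0) xpredT a isT.
exists (a i); split=> [//||d].
  by rewrite -(spec_const Uu); apply: le_spec => j; exact: ai.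
by rewrite -(spec_const Uu) => /(spec_le Uu)/(_ i).
Qed.

End OneMatrix.

Lemma posdef_mpow_congr m (A B : 'M[C]_m) r : posdef A -> posdef B ->
  posdef (mpow B r *m A *m mpow B r).
Proof.
by move=> pA pB; rewrite -{1}(adj_mpow pB); apply: (posdef_congr pA (mpowNK pB r)).
Qed.

Lemma mpow_congrK m (A B : 'M[C]_m) r : posdef A ->
  mpow A r *m (mpow A (- r) *m B *m mpow A (- r)) *m mpow A r = B.
Proof.
move=> pA; rewrite !mulmxA (mpowK pA) mul1mx -mulmxA (mpowNK pA).
by rewrite mulmx1.
Qed.

Lemma mpow_congr_le m (A B D : 'M[C]_m) r : posdef A -> B <=L D ->
  mpow A r *m B *m mpow A r <=L mpow A r *m D *m mpow A r.
Proof. by move=> pA /(@lemx_congr _ _ _ (mpow A r)); rewrite (adj_mpow pA). Qed.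

Lemma mpow_inv m (A B : 'M[C]_m) : posdef A -> A *m B = 1%:M -> mpow A (-1) = B.
Proof.
by move=> pA AB; rewrite -[LHS]mulmx1 -AB mulmxA -{2}(mpow1 pA) (mpowNK pA) mul1mx.
Qed.

(** For B = T T^* and A = T^* T this is the usual passage of a function from one
    side of T to the other. *)
Lemma mpow_intertwine m (A B T : 'M[C]_m) r : posdef A -> posdef B ->
  B *m T = T *m A -> mpow B r *m T = T *m mpow A r.
Proof.
move=> /posdef_spec[U [a [Uu a0 ->]]] /posdef_spec[V [b [Vu b0 ->]]] e.
rewrite (mpow_spec _ _ Uu) (mpow_spec _ _ Vu).
exact: (spec_intertwine (fun x => powR x r) Uu Vu e).
Qed.

Lemma posdef_sum m n (w : 'I_n -> R) (A : 'I_n -> 'M[C]_m) : (0 < n)%N ->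
  (forall j, 0 < w j) -> (forall j, posdef (A j)) ->
  posdef (\sum_j rc (w j) *: A j).
Proof.
case: n w A => // n w A _ w0 pA; split=> [|x x0].
  by rewrite adj_sum; apply: eq_bigr => j _; rewrite adjZ (posdef_adj (pA j)).
have p j : 0 < qform (rc (w j) *: A j) x.
  by have [_] := (posdefZ (pA j) (w0 j)); apply.
rewrite qform_sum big_ord_recl; apply: lt_le_trans (p ord0) _.
by rewrite lerDl sumr_ge0// => i _; apply: ltW.
Qed.

Lemma posdef_ge0 m (A : 'M[C]_m) x : posdef A -> 0 <= qform A x.
Proof.
case=> _ pA; have [->|/pA/ltW//] := eqVneq x 0.
by rewrite /qform mulmx0 mxE.
Qed.

End Powers.

(** * Jensen's operator inequality *)

Import numFieldNormedType.Exports.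

Section Jensen.
Context {R : realType} {C : cplx R}.
Local Notation rc := (@rc R C).
Local Notation re := (@re R C).

Lemma half_pow_lt (e : R) : 0 < e -> exists n, (2 ^+ n)^-1 < e.
Proof.
move=> e0; exists (Num.bound e^-1); rewrite invf_plt ?posrE ?exprn_gt0//.
rewrite (lt_trans (archi_boundP _)) ?invr_ge0 ?ltW//.
by rewrite -natrX ltr_nat ltn_expl.
Qed.

(** Bisection: the interval around s is halved at a midpoint, which stays in G. *)
Lemma midpoint_closed_dense (G : R -> Prop) : G 0 -> G 1 ->
  (forall s r, G s -> G r -> G ((s + r) / 2)) ->
  forall s, 0 <= s <= 1 -> forall e, 0 < e -> exists2 r, G r & `|s - r| < e.
Proof.
move=> G0 G1 Gmid s /andP[s0 s1] e /half_pow_lt[n ne].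
suff [l [u [Gl Gu ls su ul]]] : exists l u, [/\ G l, G u, l <= s, s <= u &
    u - l = (2 ^+ n)^-1].
  exists l => //; rewrite ger0_norm ?subr_ge0//.
  by apply: le_lt_trans ne; rewrite -ul lerD2r.
elim: n {ne} => [|n [l [u [Gl Gu ls su ul]]]].
  by exists 0, 1; rewrite expr0 invr1 subr0.
have ul' : u - l = 2 * (2 ^+ n.+1)^-1 by rewrite ul exprS invfM mulrA divff ?mul1r.
have [sm|ms] := leP s ((l + u) / 2).
  by exists l, ((l + u) / 2); split=> //; [exact: Gmid|lra].
by exists ((l + u) / 2), u; split=> //; [exact: Gmid|exact: ltW|lra].
Qed.

Lemma continuous_powR_expo (a : R) : 0 < a -> continuous (powR a).
Proof.
move=> a0; rewrite (_ : powR a = expR \o (fun s => s * ln a)); last first.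
  by apply/funext => s /=; rewrite /powR gt_eqF.
move=> s; apply: continuous_comp; last exact: continuous_expR.
exact: mulrr_continuous.
Qed.

Lemma continuous_qform_mpow m (A : 'M[C]_m) x : posdef A ->
  continuous (fun s : R => re (qform (mpow A s) x)).
Proof.
move=> /posdef_spec[U [a [Uu a0 ->]]].
rewrite (_ : (fun s => _) = fun s => \sum_i powR (a i) s * re (`|(U *m x) i 0| ^+ 2)).
  apply: continuous_big => [|i _]; first exact: add_continuous.
  by move=> s; apply: cvgMr_tmp; apply: continuous_powR_expo.
apply/funext => s; rewrite (mpow_spec _ _ Uu) qform_spec -[RHS](@rcK R C) rmorph_sum.
congr re; apply: eq_bigr => i _.
by rewrite rmorphM/= reK// ger0_real// exprn_ge0.
Qed.

Lemma re_qform m (A : 'M[C]_m) x : posdef A -> qform A x = rc (re (qform A x)).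
Proof. by move=> pA; rewrite reK// ger0_real// posdef_ge0. Qed.

Definition sesq m (A : 'M[C]_m) (x y : 'cV[C]_m) : C := (adj x *m A *m y) 0 0.

Lemma posdef1 m : posdef (1%:M : 'M[C]_m).
Proof.
have u1 : unitary (1%:M : 'M[C]_m) by rewrite /unitary adj1 mulmx1.
by rewrite -(spec1 u1); apply: spec_posdef => // i; exact: ltr01.
Qed.

Lemma sesq_mpowM m (Y : 'M[C]_m) a b x y : posdef Y ->
  (adj (mpow Y a *m x) *m (mpow Y b *m y)) 0 0 = sesq (mpow Y (a + b)) x y.
Proof. by move=> pY; rewrite adjM (adj_mpow pY) -(mpowD pY) /sesq !mulmxA. Qed.

(** Expansion of the square norm of Y^(s/2) x - Y^(r/2) y: a substitute for the
    Cauchy-Schwarz inequality that mixes two exponents. *)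
Lemma sesq_amgm m (Y : 'M[C]_m) s r x y : posdef Y ->
  sesq (mpow Y ((s + r) / 2)) x y + sesq (mpow Y ((s + r) / 2)) y x
    <= qform (mpow Y s) x + qform (mpow Y r) y.
Proof.
move=> pY.
have eB (M N P Q : 'M[C]_1) :
    (M - N - (P - Q)) 0 0 = M 0 0 - N 0 0 - (P 0 0 - Q 0 0) by rewrite !mxE.
have alg (p q p' q' : C) : 0 <= p - q - (q' - p') -> q + q' <= p + p'.
  by rewrite opprB addrACA -opprD subr_ge0.
have := posdef_ge0 (mpow Y (s / 2) *m x - mpow Y (r / 2) *m y) (posdef1 m).
rewrite /qform mulmx1 adjB mulmxBl 2!mulmxBr eB.
rewrite !(sesq_mpowM _ _ _ _ pY).
rewrite -!splitr.
have -> : r / 2 + s / 2 = (s + r) / 2 by lra.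
have -> : s / 2 + r / 2 = (s + r) / 2 by lra.
exact: alg.
Qed.

(** The inequality of arithmetic and harmonic means.  With u = S^(-1) x, where S is
    the arithmetic mean, it is the weighted sum of the inequalities
    2 Re (x, u) <= (M_j^(-1) x, x) + (M_j u, u). *)
Lemma am_hm m n (w : 'I_n -> R) (M : 'I_n -> 'M[C]_m) :
  (forall j, 0 <= w j) -> \sum_j w j = 1 -> (forall j, posdef (M j)) ->
  posdef (\sum_j rc (w j) *: M j) ->
  mpow (\sum_j rc (w j) *: M j) (-1) <=L \sum_j rc (w j) *: mpow (M j) (-1).
Proof.
move=> w0 w1 pM; set S := \sum_j _ => pS x.
pose u := mpow S (-1) *m x.
have Su : qform S u = qform (mpow S (-1)) x.
  rewrite /u -qform_congr (adj_mpow pS) -{2}(mpow1 pS) !(mpowD pS).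
  by congr (qform (mpow _ _) _); lra.
have xu : sesq 1%:M x u = qform (mpow S (-1)) x by rewrite /sesq mulmx1 mulmxA.
have ux : sesq 1%:M u x = qform (mpow S (-1)) x.
  by rewrite /sesq mulmx1 adjM (adj_mpow pS).
have key j : sesq 1%:M x u + sesq 1%:M u x <= qform (mpow (M j) (-1)) x + qform (M j) u.
  have := sesq_amgm (-1) 1 x u (pM j).
  by rewrite (_ : (-1 + 1) / 2 = 0) ?(mpow0 (pM j)) ?(mpow1 (pM j))//; lra.
rewrite -(lerD2r (qform S u)) {1}Su -{1}xu -ux.
have -> : qform (\sum_j rc (w j) *: mpow (M j) (-1)) x + qform S u =
    \sum_j rc (w j) * (qform (mpow (M j) (-1)) x + qform (M j) u).
  rewrite /S !qform_sum -big_split; apply: eq_bigr => j _.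
  by rewrite !qformZ mulrDr.
have {1}-> : sesq 1%:M x u + sesq 1%:M u x =
    \sum_j rc (w j) * (sesq 1%:M x u + sesq 1%:M u x).
  by rewrite -mulr_suml -rmorph_sum w1 rmorph1 mul1r.
by apply: ler_sum => j _; apply: ler_wpM2l; [rewrite rc_ge0|exact: key].
Qed.

(** The numbers c in N y = c D y are the eigenvalues of D^(-1/2) N D^(-1/2), and
    N <= D says that they are at most 1. *)
Lemma lemx_of_gen_eigen m (N D : 'M[C]_m) : adj N = N -> posdef D ->
  (forall (c : R) (y : 'cV[C]_m), y != 0 -> N *m y = rc c *: (D *m y) -> c <= 1) -> N <=L D.
Proof.
move=> hN pD H; pose h : R := 1 / 2.
have hh : h + h = 1 by rewrite /h; lra.
clearbody h.
pose M := mpow D (- h) *m N *m mpow D (- h).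
have hM : adj M = M by rewrite /M !adjM hN (adj_mpow pD) mulmxA.
have [U [a [Uu eM]]] := herm_spec hM.
have NE : N = mpow D h *m M *m mpow D h by rewrite /M (mpow_congrK _ _ pD).
clearbody M; have a1 i : a i <= 1.
  apply: (H _ (mpow D (- h) *m (adj U *m delta_mx i 0))).
    apply/negP => /eqP/(congr1 (mulmx (U *m mpow D h))).
    rewrite mulmx0 -mulmxA (mulmxA (mpow D h)) (mpowK pD) mul1mx mulmxA (unitaryr Uu) mul1mx.
    by move/eqP; apply/negP/delta_neq0.
  rewrite {1}NE -!mulmxA (mulmxA (mpow D h) (mpow D (- h))) (mpowK pD) mul1mx.
  rewrite eM (mulmxA (spec U a)) (spec_mulmx Uu) -(mulmxA (adj U)).
  rewrite mul_diag_mx (_ : \matrix_(_, _) _ = rc (a i) *: delta_mx i 0); last first.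
    apply/matrixP => k l; rewrite !mxE; case: (k =P i) => [->//|_].
    by rewrite !mulr0.
  rewrite -2!scalemxAr; congr (_ *: _); rewrite !mulmxA; congr (_ *m _ *m _).
  by rewrite -{2}(mpow1 pD) (mpowD pD); congr mpow; rewrite -hh addrK.
have M1 : M <=L 1%:M by rewrite eM -(spec1 Uu); exact: le_spec.
rewrite NE; apply: lemx_trans (mpow_congr_le h pD M1) _.
by rewrite mulmx1 (mpowD pD) hh (mpow1 pD).
Qed.

Section OperatorJensen.
Context {m : nat} {I : finType} (w : I -> R) (K Y : I -> 'M[C]_m) (D : 'M[C]_m).
Context (w0 : forall j, 0 <= w j) (pY : forall j, posdef (Y j)) (pD : posdef D).

Let N s := \sum_j rc (w j) *: (adj (K j) *m mpow (Y j) s *m K j).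

Let adjN s : adj (N s) = N s.
Proof.
rewrite adj_sum; apply: eq_bigr => j _.
by rewrite adjZ !adjM adjK (adj_mpow (pY j)) mulmxA.
Qed.

Let sesqN s x y : sesq (N s) x y =
  \sum_j rc (w j) * sesq (mpow (Y j) s) (K j *m x) (K j *m y).
Proof.
rewrite /sesq mulmx_sumr mulmx_suml summxE; apply: eq_bigr => j _.
by rewrite -scalemxAr -scalemxAl mxE adjM !mulmxA.
Qed.

Let qformN s x : qform (N s) x =
  \sum_j (rc (w j)) * qform (mpow (Y j) s) (K j *m x).
Proof. exact: sesqN. Qed.

Let N_amgm q s r x y : q = (s + r) / 2 ->
  sesq (N q) x y + sesq (N q) y x <= qform (N s) x + qform (N r) y.
Proof.
move=> qE; rewrite (qformN s x) (qformN r y) (sesqN q x y) (sesqN q y x).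
rewrite -[leLHS]big_split -[leRHS]big_split.
apply: ler_sum => j _ /=; rewrite -!mulrDr; apply: ler_wpM2l; first by rewrite rc_ge0.
by rewrite qE; apply: sesq_amgm.
Qed.

(** Let N_q y = c D^q y with q = (s + r) / 2.  Testing [N_amgm] against
   x = D^((r - s) / 2) y makes all four terms multiples of (D^r y, y), and the
   inequality becomes 2 c <= 2. *)
Let N_mid s r : N s <=L mpow D s -> N r <=L mpow D r ->
  N ((s + r) / 2) <=L mpow D ((s + r) / 2).
Proof.
move=> Ns Nr; have [q qE] : exists q, q = (s + r) / 2 by exists ((s + r) / 2).
rewrite -qE.
apply: lemx_of_gen_eigen => [||c y y0 Ny]; [exact: adjN|exact: posdef_mpow|].
pose x := mpow D ((r - s) / 2) *m y.
have sxy : sesq (N q) x y = rc c * qform (mpow D r) y.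
  rewrite /sesq -mulmxA Ny -scalemxAr mxE /x; congr (_ * _).
  rewrite (sesq_mpowM _ _ _ _ pD); congr (sesq (mpow _ _) _ _).
  by rewrite qE; lra.
have syx : sesq (N q) y x = rc c * qform (mpow D r) y.
  rewrite /sesq -{1}(adjN q) -adjM Ny adjZ -scalemxAl mxE /x; congr (_ * _).
  rewrite (sesq_mpowM _ _ _ _ pD); congr (sesq (mpow _ _) _ _).
  by rewrite qE; lra.
have qx : qform (mpow D s) x = qform (mpow D r) y.
  rewrite /x -qform_congr (adj_mpow pD) !(mpowD pD); congr (qform (mpow _ _) _).
  by lra.
have := le_trans (N_amgm x y qE) (lerD (Ns x) (Nr y)).
have [_ /(_ y y0)] := posdef_mpow pD r.
rewrite sxy syx qx; set Q := qform _ y => Q0.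
have -> : Q + Q = rc (1 + 1) * Q by rewrite rmorphD rmorph1 mulrDl mul1r.
by rewrite -mulrDl -rmorphD ler_pM2r// le_rc; lra.
Qed.

(** The admissible exponents s contain 0 and 1 and are stable under midpoints
    ([N_mid]); they form a closed set because both quadratic forms are continuous
    in s.  Hence they fill [0, 1]. *)
Lemma operator_jensen s : \sum_j rc (w j) *: (adj (K j) *m K j) <=L 1%:M ->
  \sum_j rc (w j) *: (adj (K j) *m Y j *m K j) <=L D -> 0 <= s <= 1 ->
  \sum_j rc (w j) *: (adj (K j) *m mpow (Y j) s *m K j) <=L mpow D s.
Proof.
move=> K1 KD s01; rewrite -/(N s).
have N_at0 : N 0 <=L mpow D 0.
  rewrite (mpow0 pD) /N; under eq_bigr => j _ do rewrite (mpow0 (pY j)) mulmx1.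
  exact: K1.
have N_at1 : N 1 <=L mpow D 1.
  rewrite (mpow1 pD) /N; under eq_bigr => j _ do rewrite (mpow1 (pY j)).
  exact: KD.
move=> x.
pose phi s := re (qform (mpow D s) x)
  - \sum_j w j * re (qform (mpow (Y j) s) (K j *m x)).
have phiE r : qform (mpow D r) x - qform (N r) x = rc (phi r).
  rewrite /phi rmorphB rmorph_sum; congr (_ - _).
    by apply/re_qform/posdef_mpow.
  rewrite qformN; apply: eq_bigr => j _; rewrite rmorphM; congr (_ * _).
  by apply/re_qform/posdef_mpow.
have phic : continuous phi.
  move=> r; apply: cvgB; first exact: continuous_qform_mpow.
  apply: cvg_big => [|j _]; first exact: add_continuous.
  by apply: cvgMl_tmp; exact: continuous_qform_mpow.
rewrite -subr_ge0 phiE rc_ge0 leNgt; apply/negP => phi0.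
have /nbhs_ballP[e /= e0 se] : \forall r \near s, phi r < 0 by exact: (cvgr_lt (phi s) (phic s)).
have [r Nr sr] := midpoint_closed_dense (G := fun s => N s <=L mpow D s) N_at0 N_at1 N_mid s01 e0.
by have := se r sr; rewrite ltNge -(@rc_ge0 R C) -phiE subr_ge0 (Nr x).
Qed.

End OperatorJensen.

Lemma loewner_heinz m (A B : 'M[C]_m) s : posdef A -> posdef B -> A <=L B ->
  0 <= s <= 1 -> mpow A s <=L mpow B s.
Proof.
move=> pA pB AB s01.
have := @operator_jensen _ 'I_1 (fun=> 1) (fun=> 1%:M) (fun=> A) B _ _ pB s.
rewrite !big_ord1 rmorph1 !scale1r adj1 !mul1mx !mulmx1.
by apply.
Qed.

Lemma hansen m (K A : 'M[C]_m) s : posdef A -> posdef (adj K *m A *m K) ->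
  adj K *m K <=L 1%:M -> 0 <= s <= 1 ->
  adj K *m mpow A s *m K <=L mpow (adj K *m A *m K) s.
Proof.
move=> pA pB K1 s01.
have := @operator_jensen _ 'I_1 (fun=> 1) (fun=> K) (fun=> A) _ _ _ pB s.
by rewrite !big_ord1 rmorph1 !scale1r; apply.
Qed.

Lemma sum_mpow_concave m n (w : 'I_n -> R) (Y : 'I_n -> 'M[C]_m) s :
  (forall j, 0 <= w j) -> \sum_j w j = 1 -> (forall j, posdef (Y j)) ->
  posdef (\sum_j rc (w j) *: Y j) -> 0 <= s <= 1 ->
  \sum_j rc (w j) *: mpow (Y j) s <=L mpow (\sum_j rc (w j) *: Y j) s.
Proof.
move=> w0 w1 pY pS s01.
have := @operator_jensen _ 'I_n w (fun=> 1%:M) Y _ w0 pY pS s.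
have e (F : 'I_n -> 'M[C]_m) :
    \sum_j rc (w j) *: (adj 1%:M *m F j *m 1%:M) = \sum_j rc (w j) *: F j.
  by apply: eq_bigr => j _; rewrite adj1 mul1mx mulmx1.
rewrite !e; apply=> //.
rewrite -scaler_suml -rmorph_sum w1 rmorph1 adj1 mul1mx scale1r.
exact: lemx_refl.
Qed.

End Jensen.

(** * Weighted geometric means and power means *)

Section GeometricMeans.
Context {R : realType} {C : cplx R}.
Local Notation rc := (@rc R C).

Lemma le_of_le_powR (c d t : R) : 0 < c -> 0 < d -> t < 1 ->
  c <= powR d (1 - t) * powR c t -> c <= d.
Proof.
move=> c0 d0 t1 H; rewrite leNgt; apply/negP => dc.
move: H; rewrite leNgt => /negP; apply.
have {2}-> : c = powR c (1 - t) * powR c t by rewrite -powR_add// subrK powRr1// ltW.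
rewrite ltr_pM2r ?powR_gt0//; apply: gt0_ltr_powR; rewrite ?nnegrE ?subr_gt0//;
  exact: ltW.
Qed.

Lemma scalar_mpow_congr m (A : 'M[C]_m) (c a b : R) : posdef A ->
  mpow A a *m (rc c)%:M *m mpow A b = rc c *: mpow A (a + b).
Proof. by move=> pA; rewrite mul_mx_scalar -scalemxAl (mpowD pA). Qed.

Lemma scale_scalar m (c d : R) : rc c *: (rc d)%:M = (rc (c * d))%:M :> 'M[C]_m.
Proof. by rewrite rmorphM scale_scalar_mx. Qed.

(** The weighted geometric mean X #_r A. *)
Definition geo m (r : R) (X A : 'M[C]_m) : 'M[C]_m :=
  mpow X (1 / 2) *m mpow (mpow X (- (1 / 2)) *m A *m mpow X (- (1 / 2))) r
  *m mpow X (1 / 2).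

(** With K = V1^(1/2) V2^(-1/2), a contraction since V1 <= V2, this is Hansen's
    inequality for V1^(-1/2) A V1^(-1/2) compressed by K. *)
Lemma geo_mono1 m (V1 V2 A : 'M[C]_m) r : posdef V1 -> posdef V2 -> posdef A ->
  V1 <=L V2 -> 0 <= r <= 1 -> geo r V1 A <=L geo r V2 A.
Proof.
move=> p1 p2 pA V12 r01; rewrite /geo; set h : R := 1 / 2.
have hh : h + h = 1 by rewrite /h; lra.
pose K := mpow V1 h *m mpow V2 (- h).
have aK : adj K = mpow V2 (- h) *m mpow V1 h by rewrite /K adjM !adj_mpow.
have pB := posdef_mpow_congr (- h) pA p1.
have KBK : adj K *m (mpow V1 (- h) *m A *m mpow V1 (- h)) *m K =
    mpow V2 (- h) *m A *m mpow V2 (- h).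
  by rewrite aK /K -[in RHS](mpow_congrK A h p1) !mulmxA.
have KK : adj K *m K <=L 1%:M.
  rewrite aK /K mulmxA -(mulmxA (mpow V2 _)) (mpowD p1) hh (mpow1 p1).
  apply: lemx_trans (mpow_congr_le (- h) p2 V12) _.
  rewrite -{2}(mpow1 p2) !(mpowD p2) (_ : _ + _ = 0) ?(mpow0 p2); first exact: lemx_refl.
  lra.
have := hansen pB _ KK r01; rewrite KBK => /(_ (posdef_mpow_congr _ pA p2)).
move=> /(mpow_congr_le h p2); rewrite aK /K; apply: lemx_trans.
rewrite !mulmxA (mpowK p2) mul1mx -!mulmxA (mpowNK p2) mulmx1 !mulmxA.
exact: lemx_refl.
Qed.

Lemma geoZ1 m (V A : 'M[C]_m) r (c : R) : posdef V -> posdef A -> 0 < c ->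
  geo r (rc c *: V) A = rc (powR c (1 - r)) *: geo r V A.
Proof.
move=> pV pA c0; rewrite /geo; set h : R := 1 / 2.
have hh : h + h = 1 by rewrite /h; lra.
rewrite !(mpowZ pV) // -!scalemxAl -!scalemxAr !scalerA -!rmorphM.
rewrite (mpowZ (posdef_mpow_congr (- h) pA pV)) ?mulr_gt0 ?powR_gt0//.
rewrite -scalemxAr -scalemxAl !scalerA -!rmorphM -!powR_add// -powRrM -!powR_add//.
congr (rc (powR _ _) *: _); have -> : - h + - h = -1 by lra.
by rewrite hh mulN1r.
Qed.

Lemma geoZ m (V A : 'M[C]_m) r (c : R) : posdef V -> posdef A -> 0 < c ->
  geo r (rc c *: V) (rc c *: A) = rc c *: geo r V A.
Proof.
move=> pV pA c0; rewrite geoZ1//; last exact: posdefZ.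
rewrite /geo -!scalemxAr -!scalemxAl.
rewrite (mpowZ (posdef_mpow_congr _ pA pV))// -!scalemxAr -!scalemxAl scalerA -rmorphM.
by rewrite -powR_add// subrK powRr1// ltW.
Qed.

Lemma geo_mpowN m (X A : 'M[C]_m) r s : posdef X ->
  geo r (mpow X (- s)) A =
  mpow X (- (s / 2)) *m mpow (mpow X (s / 2) *m A *m mpow X (s / 2)) r *m mpow X (- (s / 2)).
Proof.
move=> pX; rewrite /geo !(mpowM pX).
have -> : - s * (1 / 2) = - (s / 2) by lra.
by have -> : - s * - (1 / 2) = s / 2 by lra.
Qed.

(** Let c be the least number with P <= c V.  Since the map X -> sum_j w_j X #_r A_j
    is monotone and homogeneous of degree 1 - r, applying it to P <= c V gives
    P <= c^(1-r) V, so c <= c^(1-r) and c <= 1. *)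
Lemma power_mean_le m n (w : 'I_n -> R) (A : 'I_n -> 'M[C]_m) (P V : 'M[C]_m) r :
  (0 < m)%N -> (forall j, 0 <= w j) -> (forall j, posdef (A j)) ->
  posdef P -> posdef V -> 0 < r <= 1 ->
  P = \sum_j rc (w j) *: geo r P (A j) ->
  \sum_j rc (w j) *: geo r V (A j) <=L V -> P <=L V.
Proof.
move=> m0 w0 pA pP pV /andP[r0 r1] eP leV.
have h12 : (1 / 2 : R) + 1 / 2 = 1 by lra.
have pM := posdef_mpow_congr (- (1 / 2)) pP pV.
have [c [c0 Mc cmin]] := posdef_max_eigenvalue pM m0.
have of_M d : mpow V (- (1 / 2)) *m P *m mpow V (- (1 / 2)) <=L (rc d)%:M -> P <=L rc d *: V.
  move=> /(mpow_congr_le (1 / 2) pV); rewrite (mpow_congrK _ _ pV).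
  by rewrite (scalar_mpow_congr _ _ _ pV) h12 (mpow1 pV).
have to_M d : P <=L rc d *: V -> mpow V (- (1 / 2)) *m P *m mpow V (- (1 / 2)) <=L (rc d)%:M.
  move=> /(mpow_congr_le (- (1 / 2)) pV) H; apply: lemx_trans H _.
  rewrite -scalemxAr -scalemxAl -{2}(mpow1 pV) !(mpowD pV) (_ : _ + _ = 0); last by lra.
  by rewrite (mpow0 pV) -(rmorph1 rc) scale_scalar mulr1; exact: lemx_refl.
have Pc := of_M _ Mc.
have r01 : 0 <= r <= 1 by rewrite ltW.
have Pct : P <=L rc (powR c (1 - r)) *: V.
  rewrite eP; apply: lemx_trans (lemxZ (powR_ge0 _ _) leV).
  rewrite scaler_sumr; apply: lemx_sum => j; rewrite scalerA mulrC -scalerA.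
  apply: lemxZ => //; rewrite -geoZ1//.
  by apply: geo_mono1 => //; exact: posdefZ.
have cc := cmin _ (to_M _ Pct).
have c1 : c <= 1.
  apply: (@le_of_le_powR c 1 (1 - r)) => //; first by lra.
  by rewrite powR1 mul1r.
apply: lemx_trans Pc _; rewrite -[X in _ <=L X]scale1r -(rmorph1 rc).
by move=> x; rewrite !qformZ; apply: ler_wpM2r; [exact: posdef_ge0|rewrite le_rc].
Qed.

(** Put D = V^(-1/2) B V^(-1/2).  Hansen's inequality for B^(-1), the contraction
    V^(1/2) and the exponent 2 - q in [0, 1] gives
    V^(1/2) B^(q-2) V^(1/2) <= D^(q-2); multiplying by D on both sides turns it into
    V^(-1/2) B^q V^(-1/2) <= D^q, to which Loewner-Heinz applies. *)
Lemma ando_hiai2 m (V B : 'M[C]_m) z q : posdef V -> posdef B -> V <=L 1%:M ->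
  0 <= z <= 1 -> 1 <= q <= 2 -> geo (z / q) V (mpow B q) <=L geo z V B.
Proof.
move=> pV pB V1 /andP[z0 z1] /andP[q1 q2]; rewrite /geo; apply: mpow_congr_le => //.
set h : R := 1 / 2; have hh : h + h = 1 by rewrite /h; lra.
pose D := mpow V (- h) *m B *m mpow V (- h).
have pD : posdef D by exact: posdef_mpow_congr.
have Dinv : mpow V h *m mpow B (-1) *m mpow V h = mpow D (-1).
  symmetry; apply: mpow_inv pD _; rewrite /D !mulmxA -(mulmxA _ (mpow V (- h))).
  rewrite (mpowNK pV) mulmx1 -(mulmxA _ B) -{1}(mpow1 pB) (mpowK pB) mulmx1.
  exact: mpowNK.
have step1 : mpow V h *m mpow B (q - 2) *m mpow V h <=L mpow D (q - 2).
  have pBi := posdef_mpow pB (-1).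
  have := @hansen _ _ _ (mpow V h) _ (2 - q) pBi.
  rewrite (adj_mpow pV) Dinv (mpowD pV) hh (mpow1 pV) !mpowM//.
  rewrite (_ : -1 * (2 - q) = q - 2); last by lra.
  by apply=> //; [exact: posdef_mpow|lra].
have DB : D *m mpow V h = mpow V (- h) *m B.
  by rewrite /D -mulmxA (mpowNK pV) mulmx1.
have BD : mpow V h *m D = B *m mpow V (- h).
  by rewrite /D !mulmxA (mpowK pV) mul1mx.
have DE : mpow V (- h) *m B *m mpow V (- h) = D by [].
clearbody D; have step2 : mpow V (- h) *m mpow B q *m mpow V (- h) <=L mpow D q.
  have powq (M : 'M[C]_m) : posdef M -> mpow M 1 *m mpow M (q - 2) *m mpow M 1 = mpow M q.
    by move=> pM; rewrite !(mpowD pM); congr mpow; lra.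
  have := mpow_congr_le 1 pD step1; rewrite (powq _ pD) (mpow1 pD) !mulmxA DB.
  rewrite -(mulmxA _ _ D) BD -(powq _ pB) (mpow1 pB) !mulmxA.
  exact: id.
have zq : 0 <= z / q <= 1 by rewrite divr_ge0 ?ler_pdivrMr ?mul1r //; lra.
have pW := posdef_mpow_congr (- h) (posdef_mpow pB q) pV.
rewrite DE; have := loewner_heinz pW (posdef_mpow pD q) step2 zq.
rewrite (mpowM pD); have -> // : q * (z / q) = z by rewrite mulrC divfK// gt_eqF//; lra.
Qed.

(** The bound of [ando_hiai2] has the same form for B^(q/2) and z / (q/2), so it can
    be iterated: halve q until it is at most 2. *)
Lemma ando_hiai m (V B : 'M[C]_m) z q : posdef V -> posdef B -> V <=L 1%:M ->
  0 <= z <= 1 -> 1 <= q -> geo (z / q) V (mpow B q) <=L geo z V B.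
Proof.
move=> pV pB V1 z01 q1.
have [k] : exists k : nat, q <= 2 ^+ k.
  have q0 : 0 <= q by lra.
  exists (Num.bound q); apply: ltW; rewrite (lt_trans (archi_boundP q0))//.
  by rewrite -natrX ltr_nat ltn_expl.
elim: k q q1 => [|k IH] q q1 qk.
  by apply: ando_hiai2 => //; rewrite expr0 in qk; lra.
have [q2|q2] := leP q 2; first by apply: ando_hiai2 => //; lra.
have q21 : 1 <= q / 2 by lra.
apply: lemx_trans (IH (q / 2) q21 _); last by rewrite exprS in qk; lra.
have := @ando_hiai2 _ V (mpow B (q / 2)) (z / (q / 2)) 2 pV (posdef_mpow pB _) V1.
rewrite (mpowM pB) divfK ?pnatr_eq0// -mulrA -invfM divfK ?pnatr_eq0//.
apply; last by lra.
by rewrite divr_ge0 ?ler_pdivrMr ?mul1r //; lra.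
Qed.

End GeometricMeans.

(** * Norm bounds from the fixed-point equation *)

Section NormBounds.
Context {R : realType} {C : cplx R}.
Local Notation rc := (@rc R C).
Context {m n : nat} (w : 'I_n -> R) (z s p : R).
Context (m0 : (0 < m)%N) (n0 : (0 < n)%N).
Context (w0 : forall j, 0 < w j) (w1 : \sum_j w j = 1).
Context (z0 : 0 < z) (z1 : z < 1) (s0 : 0 < s) (s1 : s <= 1) (p0 : 0 < p)
  (spz : (s + p) * z = 1).

Definition renyi_term (X A : 'M[C]_m) : 'M[C]_m :=
  mpow X (s / 2) *m mpow A p *m mpow X (s / 2).

(** For s = t / z and p = (1 - t) / z, the fixed-point equation of the Renyi right
    mean. *)
Definition renyi_fixed (A : 'I_n -> 'M[C]_m) (X : 'M[C]_m) : Prop :=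
  X = \sum_j rc (w j) *: mpow (renyi_term X (A j)) z.

Let w_ge0 j : 0 <= w j. Proof. exact: ltW. Qed.

Section OneFamily.
Context (A : 'I_n -> 'M[C]_m) (X : 'M[C]_m).
Context (pA : forall j, posdef (A j)) (pX : posdef X) (fX : renyi_fixed A X).

Let posdef_term j : posdef (renyi_term X (A j)).
Proof. exact: posdef_mpow_congr (posdef_mpow (pA j) p) pX. Qed.

(** Bounding X <= (X^(s/2) S X^(s/2))^z by scalars gives l <= sg^(p z) l^(s z) for
    the largest eigenvalue l of X, and p z + s z = 1. *)
Lemma renyi_le_quasi_mean (S := \sum_j rc (w j) *: mpow (A j) p) (l sg : R) :
  0 < l -> 0 < sg -> X <=L (rc l)%:M -> (forall d, X <=L (rc d)%:M -> l <= d) ->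
  mpow S p^-1 <=L (rc sg)%:M -> l <= sg.
Proof.
move=> l0 sg0 Xl lmin Ssg.
have pS : posdef S by apply: posdef_sum => // j; exact: posdef_mpow.
have Sle : S <=L (rc (powR sg p))%:M.
  have := mpow_le_scalar (posdef_mpow pS p^-1) (ltW p0) Ssg.
  by rewrite (mpowM pS) mulVf ?gt_eqF// (mpow1 pS).
pose M := mpow X (s / 2) *m S *m mpow X (s / 2).
have pM : posdef M by exact: posdef_mpow_congr.
have ME : \sum_j rc (w j) *: renyi_term X (A j) = M.
  rewrite /M mulmx_sumr mulmx_suml; apply: eq_bigr => j _.
  by rewrite -scalemxAr -scalemxAl.
have Mle : M <=L (rc (powR sg p * powR l s))%:M.
  apply: lemx_trans (mpow_congr_le (s / 2) pX Sle) _.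
  rewrite (scalar_mpow_congr _ _ _ pX) -scale_scalar -splitr.
  by apply: lemxZ; [exact: powR_ge0|exact: mpow_le_scalar (ltW s0) Xl].
apply: (@le_of_le_powR _ l sg (s * z)) => //.
  by have := mulr_gt0 p0 z0; move: spz; lra.
have -> : 1 - s * z = p * z by move: spz; lra.
apply: lmin; rewrite fX.
apply: lemx_trans (sum_mpow_concave w_ge0 w1 posdef_term _ _) _ => //.
- by rewrite ME.
- by rewrite ltW//= ltW.
rewrite ME; have := mpow_le_scalar pM (ltW z0) Mle.
by rewrite powRM ?powR_ge0// -!powRrM.
Qed.

(** With D = X^(-s/2) N X^(-s/2), the sum of the inverses of the terms of the
    fixed-point equation, one has X^(-1) <= D^z.  This gives both X^(-s) <= D^(s z)
    and D >= l^(-1/z), and then D >= l^(-p) X^(-s), that is N >= l^(-p). *)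
Lemma quasi_mean_le_renyi (N := \sum_j rc (w j) *: mpow (A j) (- p)) (l : R) :
  0 < l -> X <=L (rc l)%:M -> mpow N (- p^-1) <=L (rc l)%:M.
Proof.
move=> l0 Xl.
have pN : posdef N by apply: posdef_sum => // j; exact: posdef_mpow.
pose D := mpow X (- (s / 2)) *m N *m mpow X (- (s / 2)).
have pD : posdef D by exact: posdef_mpow_congr.
have inv_term j : mpow (renyi_term X (A j)) (-1) =
    mpow X (- (s / 2)) *m mpow (A j) (- p) *m mpow X (- (s / 2)).
  apply: mpow_inv => //; rewrite /renyi_term !mulmxA -(mulmxA _ (mpow X (s / 2))).
  rewrite (mpowK pX) mulmx1 -(mulmxA _ (mpow (A j) p)) (mpowK (pA j)) mulmx1.
  exact: mpowK.
have DE : \sum_j rc (w j) *: mpow (renyi_term X (A j)) (-1) = D.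
  rewrite /D mulmx_sumr mulmx_suml; apply: eq_bigr => j _.
  by rewrite inv_term -scalemxAr -scalemxAl.
have XD : mpow X (-1) <=L mpow D z.
  have pz j : posdef (mpow (renyi_term X (A j)) z) by exact: posdef_mpow.
  have := am_hm w_ge0 w1 pz; rewrite -fX => /(_ pX) H; apply: lemx_trans H _.
  have e j : mpow (mpow (renyi_term X (A j)) z) (-1) =
      mpow (mpow (renyi_term X (A j)) (-1)) z.
    by rewrite !(mpowM (posdef_term j)) mulrC.
  under eq_bigr => j _ do rewrite e.
  have := @sum_mpow_concave _ _ _ _ w _ z w_ge0 w1
    (fun j => posdef_mpow (posdef_term j) (-1)).
  by rewrite DE => /(_ pD); apply; rewrite ltW//= ltW.
have XDs : mpow X (- s) <=L mpow D (s * z).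
  have := loewner_heinz (posdef_mpow pX _) (posdef_mpow pD z) XD (s := s).
  rewrite (mpowM pX) (mpowM pD) mulN1r [z * s]mulrC; apply.
  by rewrite ltW.
have Dl : (rc (powR l (- z^-1)))%:M <=L D.
  have H : (rc (powR l (- 1)))%:M <=L mpow D z.
    by apply: lemx_trans XD; apply: mpowN_ge_scalar.
  have := mpow_ge_scalar (posdef_mpow pD z) _ _ H (r := z^-1).
  rewrite (mpowM pD) divff ?gt_eqF// (mpow1 pD) -powRrM mulN1r; apply.
    exact: powR_gt0.
  by rewrite invr_ge0 ltW.
have sz1 : s * z <= 1 by have := mulr_gt0 p0 z0; move: spz; lra.
have ND : (rc (powR l (- p)))%:M <=L N.
  have H : rc (powR l (- p)) *: mpow X (- s) <=L D.
    apply: lemx_trans (lemxZ (powR_ge0 _ _) XDs) _.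
    have := mpow_ge_expo pD (powR_gt0 _ l0) sz1 Dl.
    rewrite -powRrM (mpow1 pD) (_ : - z^-1 * _ = - p)//.
    have -> : 1 - s * z = z * p by move: spz; lra.
    by rewrite mulNr mulKf// gt_eqF.
  have := mpow_congr_le (s / 2) pX H.
  rewrite /D (mpow_congrK _ _ pX) -scalemxAr -scalemxAl !(mpowD pX).
  rewrite (_ : _ + _ + _ = 0); last by lra.
  by rewrite (mpow0 pX) scalemx1.
have p10 : 0 <= p^-1 by rewrite invr_ge0 ltW.
have := mpowN_le_scalar pN (powR_gt0 _ l0) p10 ND.
by rewrite -powRrM mulrNN divff ?gt_eqF// powRr1 ?ltW.
Qed.

Let V := mpow X (1 - s).

Let sumX (F : 'I_n -> 'M[C]_m) (G := mpow X (- (s / 2))) :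
  \sum_j rc (w j) *: F j = X -> \sum_j rc (w j) *: (G *m F j *m G) = V.
Proof.
move=> FX; under eq_bigr => j _ do rewrite scalemxAl scalemxAr.
rewrite -mulmx_suml -mulmx_sumr FX /G -{2}(mpow1 pX) !(mpowD pX).
by congr mpow; lra.
Qed.

(** When p >= 1, Hansen's inequality with the exponent 1/p gives
    X^(s/2) A_j X^(s/2) <= (X^(s/2) A_j^p X^(s/2))^(1/p), to be raised to the power
    p z.  When p <= 1, [ando_hiai] with q = 1/p replaces A_j^p by A_j.  Either way
    the fixed-point equation sums the upper bounds to V. *)
Lemma renyi_geo_supersolution : X <=L 1%:M ->
  \sum_j rc (w j) *: geo (p * z) V (A j) <=L V.
Proof.
move=> X1; have pV : posdef V by exact: posdef_mpow.
have V1 : V <=L 1%:M.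
  by apply: mpow_le1 => //; rewrite subr_ge0.
have VX : V <=L mpow X (- s).
  have s1s : - s <= 1 - s by lra.
  have := mpow_le_expo pX ltr01 s1s; rewrite powR1 !rmorph1 scale1r.
  exact.
have pz1 : 0 <= p * z <= 1.
  have := mulr_gt0 s0 z0; have := mulr_gt0 p0 z0; move: spz; rewrite mulrDl => ? ? ?.
  by apply/andP; split; lra.
have z01 : 0 <= z <= 1 by rewrite !ltW.
have [p1|p1] := leP 1 p.
  have step j : geo (p * z) V (A j) <=L mpow X (- (s / 2)) *m
      mpow (renyi_term X (A j)) z *m mpow X (- (s / 2)).
    apply: lemx_trans (geo_mono1 pV (posdef_mpow pX _) (pA j) VX pz1) _.
    rewrite (geo_mpowN _ _ _ pX); apply: mpow_congr_le => //.
    have KAK : mpow X (s / 2) *m A j *m mpow X (s / 2) <=L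
        mpow (renyi_term X (A j)) p^-1.
      have := @hansen _ _ _ (mpow X (s / 2)) _ p^-1 (posdef_mpow (pA j) p).
      rewrite (adj_mpow pX) (mpowM (pA j)) divff ?gt_eqF// (mpow1 (pA j)).
      rewrite -/(renyi_term _ _); apply=> //; last first.
        by rewrite invr_ge0 ltW//= invf_le1// ltW.
      by rewrite (mpowD pX) -splitr; apply: mpow_le1 => //; exact: ltW.
    have := loewner_heinz (posdef_mpow_congr _ (pA j) pX)
      (posdef_mpow (posdef_term j) _) KAK pz1.
    by rewrite (mpowM (posdef_term j)) mulKf// gt_eqF.
  rewrite -[X in _ <=L X](sumX (esym fX)).
  by apply: lemx_sum => j; apply: lemxZ.
have step j : geo (p * z) V (A j) <=L mpow X (- (s / 2)) *m
    mpow (renyi_term X (A j)) z *m mpow X (- (s / 2)).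
  have := @ando_hiai _ _ _ V (mpow (A j) p) z p^-1 pV (posdef_mpow (pA j) p) V1 z01.
  rewrite (mpowM (pA j)) divff ?gt_eqF// (mpow1 (pA j)) invrK [z * p]mulrC => H.
  apply: lemx_trans (H _) _; first by rewrite invf_ge1// ltW.
  apply: lemx_trans (geo_mono1 pV (posdef_mpow pX _) (posdef_mpow (pA j) p) VX z01) _.
  by rewrite (geo_mpowN _ _ _ pX); exact: lemx_refl.
rewrite -[X in _ <=L X](sumX (esym fX)).
by apply: lemx_sum => j; apply: lemxZ.
Qed.

Lemma power_mean_le1 (P : 'M[C]_m) : posdef P ->
  P = \sum_j rc (w j) *: geo (p * z) P (A j) -> X <=L 1%:M -> P <=L 1%:M.
Proof.
move=> pP fP X1.
have pz1 : 0 < p * z <= 1.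
  have := mulr_gt0 s0 z0; have := mulr_gt0 p0 z0; move: spz; rewrite mulrDl => ? ? ?.
  by apply/andP; split; lra.
apply: (@lemx_trans _ _ _ V).
  apply: (power_mean_le m0 w_ge0 pA pP (posdef_mpow pX _) pz1 fP).
  exact: renyi_geo_supersolution.
by apply: mpow_le1 => //; rewrite subr_ge0.
Qed.

End OneFamily.

(** Both equations are homogeneous of degree 1 in (A, X) and (A, P), because
    (s + p) z = 1; dividing everything by l reduces to X <= 1. *)
Lemma power_mean_le_renyi (A : 'I_n -> 'M[C]_m) (X P : 'M[C]_m) (l : R) :
  (forall j, posdef (A j)) -> posdef X -> posdef P -> renyi_fixed A X ->
  P = \sum_j rc (w j) *: geo (p * z) P (A j) ->
  0 < l -> X <=L (rc l)%:M -> P <=L (rc l)%:M.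
Proof.
move=> pA pX pP fX fP l0 Xl; have k0 : 0 < l^-1 by rewrite invr_gt0.
have scale M : rc l^-1 *: M <=L 1%:M <-> M <=L (rc l)%:M.
  split=> [/(lemxZ (ltW l0))|/(lemxZ (ltW k0))].
    by rewrite scalerA -rmorphM divff ?gt_eqF// rmorph1 scale1r scalemx1.
  by rewrite scale_scalar mulVf ?gt_eqF// rmorph1.
apply/scale; apply: (@power_mean_le1 (fun j => rc l^-1 *: A j) (rc l^-1 *: X)).
- by move=> j; exact: posdefZ.
- exact: posdefZ.
- rewrite /renyi_fixed {1}fX scaler_sumr; apply: eq_bigr => j _.
  rewrite /renyi_term !(mpowZ pX)// (mpowZ (pA j))// -!scalemxAl -!scalemxAr.
  rewrite -scalemxAl !scalerA -!rmorphM -!powR_add//.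
  rewrite (mpowZ (posdef_mpow_congr _ (posdef_mpow (pA j) p) pX)).
    rewrite -powRrM (_ : (s / 2 + _) * z = 1) ?powRr1 ?ltW//.
      by rewrite scalerA mulrC rmorphM.
    by rewrite addrA -splitr spz.
  exact: powR_gt0.
- exact: posdefZ.
- rewrite {1}fP scaler_sumr; apply: eq_bigr => j _.
  by rewrite geoZ// !scalerA mulrC.
- exact/scale.
Qed.

End NormBounds.

(** * Scalar and trace estimates *)

Section ScalarBounds.
Context {R : realType}.
Implicit Types a b u r : R.

Lemma powR_tangent_scale a b r (c : R) : 0 < a -> 0 < b ->
  powR a r * (c * (b / a - 1)) = c * powR a (r - 1) * (b - a).
Proof.
move=> a0 b0; rewrite -[in LHS](subrK 1 r) (powR_add (r - 1) 1 a0) powRr1 ?ltW//.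
by field; rewrite gt_eqF.
Qed.

Lemma powR_div_scale a b r : 0 < a -> 0 < b -> powR b r = powR a r * powR (b / a) r.
Proof.
by move=> a0 b0; rewrite -powRM ?divr_ge0 ?ltW// mulrC divfK// gt_eqF.
Qed.

(** Writing b / a = exp y, this is the convexity of exp, obtained as the sum of
    exp x >= 1 + x at x = (1 - u) y and x = - u y with weights u and 1 - u. *)
Lemma powR_le_tangent a b u : 0 < a -> 0 < b -> 0 <= u <= 1 ->
  powR b u <= powR a u + u * powR a (u - 1) * (b - a).
Proof.
move=> a0 b0 /andP[u0 u1].
rewrite -powR_tangent_scale// (powR_div_scale _ a0 b0) -[X in X + _]mulr1 -mulrDr.
rewrite ler_pM2l ?powR_gt0//; set x := b / a; have x0 : 0 < x by rewrite divr_gt0.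
pose y := ln x; have xE : x = expR y by rewrite lnK.
have -> : powR x u = expR (u * y) by rewrite /powR gt_eqF.
have e1 : u * (1 + (1 - u) * y) <= u * expR ((1 - u) * y).
  by apply: ler_wpM2l => //; exact: expR_ge1Dx.
have e2 : (1 - u) * (1 - u * y) <= (1 - u) * expR (- (u * y)).
  by apply: ler_wpM2l; [lra|exact: expR_ge1Dx].
have key : 1 <= u * expR ((1 - u) * y) + (1 - u) * expR (- (u * y)) by lra.
have := ler_wpM2r (ltW (expR_gt0 (u * y))) key.
rewrite mul1r mulrDl -!mulrA -!expRD (_ : (1 - u) * y + u * y = y); last by lra.
by rewrite addNr expR0 -xE; lra.
Qed.

Lemma powR_ge_tangent a b r : 0 < a -> 0 < b -> r <= 0 ->
  powR a r + r * powR a (r - 1) * (b - a) <= powR b r.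
Proof.
move=> a0 b0 r0.
rewrite -powR_tangent_scale// (powR_div_scale _ a0 b0) -[X in X + _]mulr1 -mulrDr.
rewrite ler_pM2l ?powR_gt0//; set x := b / a; have x0 : 0 < x by rewrite divr_gt0.
pose y := ln x; have xE : x = expR y by rewrite lnK.
have -> : powR x r = expR (r * y) by rewrite /powR gt_eqF.
have e1 := expR_ge1Dx (r * y).
have e2 : r * (x - 1) <= r * y.
  by apply: ler_wnM2l => //; have := expR_ge1Dx y; rewrite -xE; lra.
lra.
Qed.

(** The tangent bound for the convex function of exponent z - 1, multiplied by b. *)
Lemma powR_quad_lower a b z : 0 < a -> 0 < b -> 0 < z < 1 ->
  powR a z + z * powR a (z - 1) * (b - a)
    - (1 - z) * powR a (z - 1 - 1) * (b - a) ^+ 2 <= powR b z.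
Proof.
move=> a0 b0 /andP[z0 z1].
have z10 : z - 1 <= 0 by lra.
have := ler_wpM2l (ltW b0) (powR_ge_tangent a0 b0 z10).
have powS (x : R) : 0 < x -> x * powR x (z - 1) = powR x z.
  by move=> x0; rewrite mulrC -[X in _ * X](powRr1 (ltW x0)) -powR_add// subrK.
rewrite (powS b)// -(powS a)//.
have -> : powR a (z - 1) = a * powR a (z - 1 - 1).
  by rewrite mulrC -[X in _ * X](powRr1 (ltW a0)) -powR_add// subrK.
set q := powR a _ => H; apply: le_trans H; rewrite le_eqVlt; apply/orP; left.
by apply/eqP; ring.
Qed.

(** Multiplying the bound for u - 1 by b gives the bound for u; the remainder grows
    with b, whence the restriction to b <= M. *)
Lemma powR_quad_upper a u (M : R) : 0 < a -> 0 <= u -> 0 <= M -> exists K, 0 <= K /\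
  forall b, 0 < b -> b <= M ->
    powR b u <= powR a u + u * powR a (u - 1) * (b - a) + K * (b - a) ^+ 2.
Proof.
move=> a0 u0 M0; have [k] : exists k : nat, u <= k%:R.
  by exists (Num.bound u); apply/ltW/archi_boundP.
elim: k u u0 => [|k IH] u u0 uk.
  exists 0; split=> // b b0 _; rewrite mul0r addr0; apply: powR_le_tangent => //.
  by apply/andP; split; lra.
have [u1|u1] := leP u 1.
  exists 0; split=> // b b0 _; rewrite mul0r addr0; apply: powR_le_tangent => //.
  by apply/andP; split; lra.
have u10 : 0 <= u - 1 by lra.
have [|K [K0 HK]] := IH (u - 1) u10; first by rewrite -natr1 in uk; lra.
exists ((u - 1) * powR a (u - 1 - 1) + K * M); split.
  by rewrite addr_ge0 ?mulr_ge0 ?powR_ge0.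
move=> b b0 bM; have := ler_wpM2l (ltW b0) (HK b b0 bM).
have powS (x : R) : 0 < x -> x * powR x (u - 1) = powR x u.
  by move=> x0; rewrite mulrC -[X in _ * X](powRr1 (ltW x0)) -powR_add// subrK.
have powS1 : a * powR a (u - 1 - 1) = powR a (u - 1).
  by rewrite mulrC -[X in _ * X](powRr1 (ltW a0)) -powR_add// subrK.
have KM : K * b * (b - a) ^+ 2 <= K * M * (b - a) ^+ 2.
  by rewrite ler_wpM2r ?sqr_ge0// ler_wpM2l.
rewrite (powS b)// -(powS a)// -powS1; set q := powR a _ => H; apply: le_trans H _.
rewrite -subr_ge0; rewrite -subr_ge0 in KM; apply: le_trans KM _.
by rewrite le_eqVlt; apply/orP; left; apply/eqP; ring.
Qed.

End ScalarBounds.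

Section Trace.
Context {R : realType} {C : cplx R}.
Local Notation rc := (@rc R C).
Local Notation re := (@re R C).

Lemma tr_spec m (U : 'M[C]_m) a : unitary U -> \tr (spec U a) = rc (\sum_i a i).
Proof.
move=> Uu; rewrite specE -mulmxA mxtrace_mulC -mulmxA (unitaryr Uu) mulmx1.
by rewrite mxtrace_diag rmorph_sum; apply: eq_bigr => i _; rewrite mxE.
Qed.

Lemma tr_specM m (U V : 'M[C]_m) a b :
  \tr (spec U a *m spec V b) =
  \sum_i \sum_j rc (a i * b j) * `|(U *m adj V) i j| ^+ 2.
Proof.
rewrite !specE -!mulmxA mxtrace_mulC !mulmxA -(mulmxA _ U (adj V)).
rewrite -!(mulmxA _ V (adj U)) -[V *m adj U]adjK adjM adjK.
set W := U *m adj V; rewrite /mxtrace; apply: eq_bigr => i _.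
rewrite -mulmxA mxE; apply: eq_bigr => j _.
rewrite mul_diag_mx mul_diag_mx !mxE rmorphM normCK -!mulrA; congr (_ * _).
by rewrite mulrCA.
Qed.

(** With W the matrix of scalar products of the two eigenbases, every trace here is
    of the form sum_ij c_ij |W_ij|^2, where c_ij depends on the eigenvalues a_i and
    b_j only, so the scalar inequality can be summed with the weights |W_ij|^2. *)
Lemma tr_quad_le m (U V : 'M[C]_m) a b (f g : R -> R) (K : R) :
  unitary U -> unitary V ->
  (forall i j, f (b j) <= f (a i) + g (a i) * (b j - a i) + K * (b j - a i) ^+ 2) ->
  \tr (spec V (f \o b)) <= \tr (spec U (f \o a))
    + \tr (spec U (g \o a) *m (spec V b - spec U a))
    + rc K * \tr ((spec V b - spec U a) *m (spec V b - spec U a)).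
Proof.
move=> Uu Vu H; pose T (x y : 'I_m -> R) := \tr (spec U x *m spec V y).
have l1 y : \tr (spec V y) = T (fun=> 1) y by rewrite /T (spec1 Uu) mul1mx.
have r1 x : \tr (spec U x) = T x (fun=> 1) by rewrite /T (spec1 Vu) mulmx1.
rewrite !mulmxBr !mulmxBl !(specM Uu) !(specM Vu) (linearB (@mxtrace _ m)) /=.
rewrite [\tr (_ - _ - _)]linearB /= ![\tr (_ - _)]linearB /=.
rewrite (mxtrace_mulC (spec V b)) !l1 !r1 -!/(T _ _).
rewrite -subr_ge0 /T !tr_specM.
rewrite -!sumrB mulr_sumr -!big_split -sumrB /=; apply: sumr_ge0 => i _.
rewrite -!sumrB mulr_sumr -!big_split -sumrB /=; apply: sumr_ge0 => j _.
set q := `|_| ^+ 2; have q0 : 0 <= q by rewrite exprn_ge0.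
have := H i j; rewrite -subr_ge0 -(@rc_ge0 R C) => /mulr_ge0/(_ q0).
congr (0 <= _); rewrite !(rmorphB, rmorphD, rmorphM, rmorphXn, rmorph1) /=.
by ring.
Qed.

End Trace.

Section FirstOrder.
Context {R : realType} {C : cplx R}.
Local Notation rc := (@rc R C).
Local Notation re := (@re R C).

Lemma uniform_bound (I : finType) (P : I -> R -> Prop) :
  (forall i (K L : R), K <= L -> P i K -> P i L) ->
  (forall i, exists K, 0 <= K /\ P i K) -> exists K, 0 <= K /\ forall i, P i K.
Proof.
move=> Pmono /choice[K HK]; exists (\sum_i K i); split.
  by apply: sumr_ge0 => i _; case: (HK i).
move=> i; apply: Pmono (HK i).2; rewrite (bigD1 i)//= lerDl sumr_ge0// => j _.
by case: (HK j).
Qed.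

Lemma herm_tr_sqr_ge0 m (H : 'M[C]_m) : adj H = H -> 0 <= \tr (H *m H).
Proof.
case/herm_spec => U [a [Uu ->]]; rewrite (specM Uu) (tr_spec _ Uu) rc_ge0.
by apply: sumr_ge0 => i _; rewrite -expr2 sqr_ge0.
Qed.

Lemma herm_tr_sqr_eq0 m (H : 'M[C]_m) : adj H = H -> \tr (H *m H) <= 0 -> H = 0.
Proof.
case/herm_spec => U [a [Uu ->]]; rewrite (specM Uu) (tr_spec _ Uu).
rewrite -(rmorph0 rc) le_rc => s0.
have a0 i : a i = 0.
  have sq0 j : true -> 0 <= a j * a j by rewrite -expr2 sqr_ge0.
  have s00 : \sum_i a i * a i = 0 by apply/eqP; rewrite eq_le s0 sumr_ge0.
  have /eqP := @psumr_eq0P _ _ predT _ sq0 s00 i isT; rewrite mulf_eq0 orbb => ai; exact/eqP.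
by rewrite (eq_spec U a0) (spec_const Uu) rmorph0 raddf0.
Qed.

Lemma herm_tr_real m (H : 'M[C]_m) : adj H = H -> \tr H = rc (re (\tr H)).
Proof.
by case/herm_spec => U [a [Uu ->]]; rewrite (tr_spec _ Uu) rcK.
Qed.

Lemma tr_mpow_lower m (G : 'M[C]_m) z : posdef G -> 0 < z < 1 -> exists K, 0 <= K /\
  forall G', posdef G' ->
    \tr (mpow G z) + rc z * \tr (mpow G (z - 1) *m (G' - G))
      - rc K * \tr ((G' - G) *m (G' - G)) <= \tr (mpow G' z).
Proof.
move=> /posdef_spec[U [a [Uu a0 ->]]] z01.
pose P i K := forall b : R, 0 < b -> powR (a i) z + z * powR (a i) (z - 1) * (b - a i)
    - K * (b - a i) ^+ 2 <= powR b z.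
have [K [K0 HK]] : exists K, 0 <= K /\ forall i, P i K.
  apply: uniform_bound => [i K L KL H b b0|i].
    by apply: le_trans (H b b0); rewrite lerD2l lerN2 ler_wpM2r// sqr_ge0.
  exists ((1 - z) * powR (a i) (z - 1 - 1)); split.
    by rewrite mulr_ge0 ?powR_ge0//; lra.
  by move=> b b0; apply: powR_quad_lower.
exists K; split=> // _ /posdef_spec[V [b [Vu b0 ->]]].
have H : \tr (spec V (fun i => - powR (b i) z)) <= \tr (spec U (fun i => - powR (a i) z))
    + \tr (spec U (fun i => - (z * powR (a i) (z - 1))) *m (spec V b - spec U a))
    + rc K * \tr ((spec V b - spec U a) *m (spec V b - spec U a)).
  apply: (@tr_quad_le _ _ _ U V a b (fun x => - powR x z)
    (fun x => - (z * powR x (z - 1))) K Uu Vu) => i j.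
  by have := HK i _ (b0 j); lra.
have N (W : 'M[C]_m) c : spec W (fun i => - c i) = - spec W c.
  by rewrite -scaleN1r -(rmorph1 rc) -rmorphN specZ; apply: eq_spec => i; rewrite mulN1r.
have Z (W : 'M[C]_m) c : spec W (fun i => z * c i) = rc z *: spec W c by rewrite specZ.
rewrite !(mpow_spec _ _ Uu) (mpow_spec _ _ Vu).
move: H; rewrite !N Z mulNmx -scalemxAl ![\tr (- _)]linearN /= mxtraceZ.
rewrite -subr_ge0 => H; rewrite -subr_ge0; move: H; congr (0 <= _); ring.
Qed.

(** The eigenvalues of Z' are bounded by its trace, which makes the constant of
    [powR_quad_upper] uniform. *)
Lemma tr_mpow_upper m (Z : 'M[C]_m) (u T : R) : posdef Z -> 0 <= u -> exists K, 0 <= K /\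
  forall Z', posdef Z' -> \tr Z' <= rc T ->
    \tr (mpow Z' u) <= \tr (mpow Z u) + rc u * \tr (mpow Z (u - 1) *m (Z' - Z))
      + rc K * \tr ((Z' - Z) *m (Z' - Z)).
Proof.
move=> /posdef_spec[U [a [Uu a0 ->]]] u0.
pose P i K := forall b : R, 0 < b -> b <= Num.max 0 T ->
  powR b u <= powR (a i) u + u * powR (a i) (u - 1) * (b - a i) + K * (b - a i) ^+ 2.
have [K [K0 HK]] : exists K, 0 <= K /\ forall i, P i K.
  apply: uniform_bound => [i K L KL H b b0 bM|i].
    by apply: le_trans (H b b0 bM) _; rewrite lerD2l ler_wpM2r// sqr_ge0.
  by apply: powR_quad_upper => //; rewrite le_max lexx.
exists K; split=> // _ /posdef_spec[V [b [Vu b0 ->]]].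
rewrite (tr_spec _ Vu) le_rc => bT.
have bM j : b j <= Num.max 0 T.
  rewrite le_max; apply/orP; right; apply: le_trans bT.
  by rewrite (bigD1 j)//= lerDl sumr_ge0// => k _; apply: ltW.
have := @tr_quad_le _ _ _ U V a b (fun x => powR x u) (fun x => u * powR x (u - 1))
  K Uu Vu (fun i j => HK i _ (b0 j) (bM j)).
have Zs (W : 'M[C]_m) c : spec W (fun i => u * c i) = rc u *: spec W c by rewrite specZ.
by rewrite /comp /= Zs !(mpow_spec _ _ Uu) (mpow_spec _ _ Vu) -scalemxAl mxtraceZ.
Qed.

Lemma posdef_perturb m (Z H : 'M[C]_m) : (0 < m)%N -> posdef Z -> adj H = H ->
  exists e0 : R, [/\ 0 < e0, e0 <= 1 & forall e, 0 < e -> e <= e0 -> posdef (Z - rc e *: H)].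
Proof.
move=> m0 pZ hH.
(* The largest eigenvalue c of the inverse of Z bounds Z below by 1 / c. *)
have [c [c0 Zc _]] := posdef_max_eigenvalue (posdef_mpow pZ (-1)) m0.
have {}Zc : (rc c^-1)%:M <=L Z.
  have := mpowN_ge_scalar (posdef_mpow pZ (-1)) c0 ler01 Zc.
  by rewrite (mpowM pZ) mulrNN mulr1 (mpow1 pZ) powR_inv1 ?ltW.
have [U [a [Uu HE]]] := herm_spec hH.
pose eta := 1 + \sum_i `|a i|.
have eta1 : 1 <= eta by rewrite lerDl sumr_ge0.
have Heta : H <=L (rc eta)%:M.
  rewrite HE -(spec_const Uu); apply: le_spec => i.
  apply: le_trans (ler_norm _) _; rewrite /eta (bigD1 i)//= addrCA lerDl.
  by rewrite addr_ge0 ?sumr_ge0.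
have c'0 : 0 < c^-1 by rewrite invr_gt0.
(* Up to this e0 the perturbation takes away at most half of the bound 1 / c. *)
exists (Num.min 1 (c^-1 / (2 * eta))); split; first by rewrite lt_min ltr01/= divr_gt0//; lra.
  by rewrite ge_min lexx.
move=> e e0; rewrite le_min => /andP[_]; rewrite ler_pdivlMr; last by lra.
move=> ec; split=> [|x x0].
  by rewrite adjB adjZ hH (posdef_adj pZ).
have q0 : 0 < qform 1%:M x by have [_] := posdef1 (C := C) m; apply.
have s1 : qform ((rc c^-1)%:M - rc e *: (rc eta)%:M) x <= qform (Z - rc e *: H) x.
  rewrite !qformB !qformZ; apply: lerB; first exact: Zc.
  by apply: ler_wpM2l; [rewrite rc_ge0 ltW|exact: Heta].
apply: lt_le_trans s1.
have -> : (rc c^-1)%:M - rc e *: (rc eta)%:M = rc (c^-1 - e * eta) *: 1%:M :> 'M[C]_m.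
  by rewrite scalemx1 scale_scalar rmorphB raddfB.
by rewrite qformZ mulr_gt0// rc_gt0; move: ec; rewrite -/eta mulrCA; lra.
Qed.

End FirstOrder.

(** * The fixed-point equation of the Renyi right mean *)

Lemma ler_cancel_addl (C : numDomainType) (a b c d f : C) :
  a + b - c <= a + d - f -> b - c <= d - f.
Proof. by rewrite -!addrA lerD2l. Qed.

Lemma mpowB1 (R : realType) (C : cplx R) m (M : 'M[C]_m) r : posdef M ->
  mpow M (r - 1) *m M = mpow M r.
Proof. by move=> pM; rewrite -{2}(mpow1 pM) (mpowD pM) subrK. Qed.

Section Stationary.
Context {R : realType} {C : cplx R}.
Local Notation rc := (@rc R C).
Local Notation re := (@re R C).
Context {m n : nat} (w : 'I_n -> R) (A : 'I_n -> 'M[C]_m) (X : 'M[C]_m) (t z : R).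
Context (m0 : (0 < m)%N).
Context (w0 : forall j, 0 < w j) (w1 : \sum_j w j = 1).
Context (pA : forall j, posdef (A j)) (pX : posdef X).
Context (t0 : 0 < t) (tz : t <= z) (z1 : z < 1).

Definition renyi_core (B Z : 'M[C]_m) : 'M[C]_m :=
  mpow B ((1 - t) / (2 * z)) *m Z *m mpow B ((1 - t) / (2 * z)).

(** The objective on matrices over an abstract complex field; its instance at [Rcx]
    is [renyi_objective] ([renyi_objectiveE]). *)
Definition renyi_obj (Y : 'M[C]_m) : R :=
  \sum_j w j * (re (\tr (rc (1 - t) *: A j + rc t *: Y))
    - re (\tr (mpow (renyi_core (A j) (mpow Y (t / z))) z))).

Let z0 : 0 < z. Proof. exact: lt_le_trans tz. Qed.

Lemma rc_renyi_obj Y : posdef Y -> rc (renyi_obj Y) =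
  (\sum_j rc (w j) * (rc (1 - t) * \tr (A j))) + rc t * \tr Y
  - \sum_j rc (w j) * \tr (mpow (renyi_core (A j) (mpow Y (t / z))) z).
Proof.
move=> pY.
have -> : rc t * \tr Y = \sum_j rc (w j) * (rc t * \tr Y).
  by rewrite -mulr_suml -rmorph_sum w1 rmorph1 mul1r.
rewrite -big_split -sumrB /renyi_obj rmorph_sum; apply: eq_bigr => j _ /=.
rewrite rmorphM rmorphB -mulrDr -mulrBr; congr (_ * (_ - _)).
  rewrite -herm_tr_real; first by rewrite mxtraceD !mxtraceZ.
  by rewrite adjD !adjZ (posdef_adj (pA j)) (posdef_adj pY).
rewrite -herm_tr_real// adj_mpow//.
by apply: posdef_mpow_congr (pA j); exact: posdef_mpow.
Qed.

Let s := t / z.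
Let p := (1 - t) / z.
Let Z := mpow X s.
Let B j := mpow (A j) ((1 - t) / (2 * z)).
Let G j := renyi_core (A j) Z.
Let L := \sum_j rc (w j) *: (B j *m mpow (G j) (z - 1) *m B j).
Let D := mpow X (1 - s) - L.

Let s0 : 0 < s. Proof. by rewrite divr_gt0. Qed.
Let pZ : posdef Z. Proof. exact: posdef_mpow. Qed.
Let pcore j W : posdef W -> posdef (renyi_core (A j) W).
Proof. by move=> pW; exact: posdef_mpow_congr. Qed.

Let hD : adj D = D.
Proof.
rewrite /D adjB (adj_mpow pX) /L adj_sum; congr (_ - _); apply: eq_bigr => j _.
by rewrite adjZ !adjM /B !(adj_mpow (pA j)) (adj_mpow (pcore j pZ)) mulmxA.
Qed.

(** In the variable Z = X^s the gradient of the objective is z D.  Moving from Z to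
    Z - e D changes the objective by at most - e z tr D^2 + e^2 k, so minimality
    forces z tr D^2 <= e k for all small e > 0, and D = 0. *)
Lemma renyi_stationary :
  (forall Y, posdef Y -> renyi_obj X <= renyi_obj Y) -> mpow X (1 - s) = L.
Proof.
move=> Xmin; apply/subr0_eq; rewrite -/D; apply: herm_tr_sqr_eq0 hD _.
have [e0 [e00 e01 pe]] := posdef_perturb m0 pZ hD.
have u0 : 0 <= s^-1 by rewrite invr_ge0 ltW.
have trZ : \tr Z = rc (re (\tr Z)) by apply/herm_tr_real/posdef_adj.
have trD : \tr D = rc (re (\tr D)) by apply/herm_tr_real.
have [K0 [K00 HK0]] := tr_mpow_upper (re (\tr Z) + `|re (\tr D)|) pZ u0.
have z01 : 0 < z < 1 by rewrite z0.
have exK j : exists K, 0 <= K /\ forall G', posdef G' ->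
    \tr (mpow (G j) z) + rc z * \tr (mpow (G j) (z - 1) *m (G' - G j))
      - rc K * \tr ((G' - G j) *m (G' - G j)) <= \tr (mpow G' z).
  exact: tr_mpow_lower (pcore j pZ) z01.
have [K HK] := choice exK.
pose E j := B j *m D *m B j.
have hE j : adj (E j) = E j by rewrite /E !adjM hD !(adj_mpow (pA j)) mulmxA.
pose q := re (\tr (D *m D)).
have qE : \tr (D *m D) = rc q.
  by rewrite /q reK// ger0_real// herm_tr_sqr_ge0.
pose k := t * K0 * q + \sum_j w j * (K j * re (\tr (E j *m E j))).
have main e : 0 < e -> e <= e0 -> z * q <= e * k.
  move=> e_gt0 ee0; have pZe := pe e e_gt0 ee0.
  set Ze := Z - rc e *: D in pZe; set Y := mpow Ze s^-1.
  have dZ : Ze - Z = - (rc e *: D) by rewrite /Ze addrAC subrr add0r.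
  have ZeE : mpow Y (t / z) = Ze by rewrite (mpowM pZe) mulVf ?gt_eqF// (mpow1 pZe).
  have pY : posdef Y by exact: posdef_mpow.
  have trE (M : 'M[C]_m) : \tr (rc e *: M) = rc e * \tr M by exact: mxtraceZ.
  have h1 : rc t * \tr X - \sum_j rc (w j) * \tr (mpow (G j) z)
      <= rc t * \tr Y - \sum_j rc (w j) * \tr (mpow (renyi_core (A j) Ze) z).
    have := Xmin _ pY; rewrite -(@le_rc R C) !rc_renyi_obj// ZeE.
    exact: ler_cancel_addl.
  have h2 : \tr Y <= \tr X - rc (s^-1 * e) * \tr (mpow X (1 - s) *m D) + rc (K0 * e ^+ 2 * q).
    have trZe : \tr Ze <= rc (re (\tr Z) + `|re (\tr D)|).
      rewrite /Ze mxtraceD raddfN /= trE {1}trZ {1}trD -rmorphM -rmorphB le_rc lerD2l.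
      rewrite -mulNr; apply: le_trans (ler_norm _) _; rewrite normrM normrN (gtr0_norm e_gt0).
      by apply: ler_piMl; [exact: normr_ge0|exact: le_trans ee0 e01].
    have := HK0 _ pZe trZe; rewrite dZ !mulmxN !mulNmx opprK -!scalemxAr -scalemxAl.
    rewrite scalerA raddfN /= !mxtraceZ qE !(mpowM pX) -!rmorphM.
    rewrite mulrBr mulr1 divff ?gt_eqF// (mpow1 pX) mulrN mulrA -!rmorphM.
    by rewrite (_ : K0 * (e * e * q) = K0 * e ^+ 2 * q) // expr2; ring.
  have h3 : \sum_j rc (w j) * \tr (mpow (G j) z) + rc (- (z * e)) * \tr (L *m D)
       - rc (e ^+ 2 * \sum_j w j * (K j * re (\tr (E j *m E j))))
      <= \sum_j rc (w j) * \tr (mpow (renyi_core (A j) Ze) z).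
    have -> : \tr (L *m D) = \sum_j rc (w j) * \tr (mpow (G j) (z - 1) *m E j).
      rewrite /L mulmx_suml raddf_sum; apply: eq_bigr => j _ /=.
      rewrite -scalemxAl mxtraceZ /E -!mulmxA mxtrace_mulC -!mulmxA.
      by [].
    rewrite [rc (e ^+ 2 * _)]rmorphM rmorph_sum !mulr_sumr -big_split -sumrB.
    apply: ler_sum => j _ /=.
    have pGe : posdef (renyi_core (A j) Ze) by exact: pcore.
    have dG : renyi_core (A j) Ze - G j = - (rc e *: E j).
      rewrite /G /renyi_core -mulmxBl -mulmxBr dZ mulmxN mulNmx.
      by rewrite -scalemxAr -scalemxAl.
    have := (HK j).2 _ pGe; rewrite dG !mulmxN !mulNmx opprK -!scalemxAr -scalemxAl.
    rewrite scalerA raddfN /= !mxtraceZ => hj.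
    have w0j : 0 <= rc (w j) by rewrite rc_ge0 ltW.
    apply: le_trans (ler_wpM2l w0j hj); rewrite le_eqVlt; apply/orP; left; apply/eqP.
    have trEE : \tr (E j *m E j) = rc (re (\tr (E j *m E j))).
      by rewrite reK// ger0_real// herm_tr_sqr_ge0.
    rewrite {2}trEE expr2 rmorphN !rmorphM; ring.
  have XLD : rc q = \tr (mpow X (1 - s) *m D) - \tr (L *m D).
    by rewrite -qE -raddfB -mulmxBl.
  have tu : rc t * rc s^-1 = rc z.
    by rewrite -rmorphM /s invf_div mulrCA divff ?mulr1// gt_eqF.
  have h4 : 0 <= rc (e * (e * k - z * q)).
    have := lerD (lerD h1 h3) (ler_wpM2l (_ : 0 <= rc t) h2).
    rewrite rc_ge0 => /(_ (ltW t0)); rewrite -subr_ge0; congr (0 <= _).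
    rewrite /k expr2 !(rmorphM, rmorphB, rmorphD, rmorphN) /= -tu XLD.
    set S1 := \sum_j _; set S2 := \sum_j _; set S3 := rc (\sum_j _).
    ring.
  by move: h4; rewrite rc_ge0 pmulr_rge0// subr_ge0.
rewrite qE -(rmorph0 rc) le_rc leNgt; apply/negP => q0.
have k0 : 0 < k.
  by have := main e0 e00 (lexx _); have := mulr_gt0 z0 q0 => h1 h2;
     rewrite -(pmulr_rgt0 _ e00); apply: lt_le_trans h2.
(* At most half of the value at which e * k reaches z * q. *)
pose e := Num.min e0 (z * q / (2 * k)).
have zq0 : 0 < z * q by exact: mulr_gt0.
have e_gt0 : 0 < e by rewrite lt_min e00 divr_gt0// mulr_gt0.
have := main e e_gt0; rewrite ge_min lexx => /(_ isT).
have : e <= z * q / (2 * k) by rewrite ge_min lexx orbT.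
rewrite ler_pdivlMr ?mulr_gt0// mulrCA => h1 h2; move: zq0 h1 h2.
lra.
Qed.

(** Conjugating the stationarity equation by X^(s/2) and moving the power from
    G_j = T^* T to T T^*, where T = X^(s/2) A_j^(p/2), gives the fixed-point form. *)
Lemma renyi_min_fixed :
  (forall Y, posdef Y -> renyi_obj X <= renyi_obj Y) -> renyi_fixed w z s p A X.
Proof.
move=> /renyi_stationary XL.
have XE : X = mpow X (s / 2) *m L *m mpow X (s / 2).
  by rewrite -XL !(mpowD pX) -[LHS](mpow1 pX); congr mpow; lra.
rewrite /renyi_fixed {1}XE /L mulmx_sumr mulmx_suml; apply: eq_bigr => j _.
rewrite -scalemxAr -scalemxAl; congr (_ *: _).
pose T := mpow X (s / 2) *m B j.
have BB : B j *m B j = mpow (A j) p.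
  by rewrite /B (mpowD (pA j)); congr mpow; rewrite /p; field; rewrite gt_eqF.
have YT : renyi_term s p X (A j) = T *m (B j *m mpow X (s / 2)).
  by rewrite /renyi_term -BB /T !mulmxA.
have GT : G j = (B j *m mpow X (s / 2)) *m T.
  by rewrite /T mulmxA -(mulmxA (B j) (mpow X _) (mpow X _)) (mpowD pX) -splitr.
have pY : posdef (renyi_term s p X (A j)).
  exact: posdef_mpow_congr (posdef_mpow (pA j) p) pX.
have e : mpow (renyi_term s p X (A j)) (z - 1) *m T = T *m mpow (G j) (z - 1).
  apply: mpow_intertwine (pcore j pZ) pY _.
  by rewrite YT -/(G j) GT !mulmxA.
have -> : mpow X (s / 2) *m (B j *m mpow (G j) (z - 1) *m B j) *m mpow X (s / 2) =
    T *m mpow (G j) (z - 1) *m (B j *m mpow X (s / 2)) by rewrite /T !mulmxA.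
clearbody T; rewrite -e -(mulmxA _ T) -YT.
by rewrite (mpowB1 _ pY).
Qed.

End Stationary.

(** * Operator norm and the theorem *)

Local Open Scope complex_scope.

Section ComplexMatrices.
Context {R : realType}.

Definition Rcx : cplx R := @Cplx R R[i] (real_complex R) (@complex.Re R)
  (fun=> erefl) (@RRe_real R) (@lecR R).

Lemma posdefmxE m (A : 'M[R[i]]_m) : posdefmx A <-> @posdef R Rcx m A.
Proof. by split=> -[hA qA]; split=> //; apply/(@hermE R Rcx). Qed.

Lemma mxpowRE m (A : 'M[R[i]]_m) r : mxpowR A r = @mpow R Rcx m A r.
Proof. by rewrite unlock. Qed.

Lemma vecnorm_qform m (x : 'cV[R[i]]_m) :
  rc Rcx (vecnorm x ^+ 2) = @qform R Rcx m 1%:M x.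
Proof.
rewrite /vecnorm sqr_sqrtr; last by apply: sumr_ge0 => i _; rewrite sqr_ge0.
rewrite rmorph_sum /qform mulmx1 mxE; apply: eq_bigr => i _.
by rewrite /adj !mxE -normCKC rmorphXn.
Qed.

Lemma vecnorm_ge0 m (x : 'cV[R[i]]_m) : 0 <= vecnorm x.
Proof. exact: sqrtr_ge0. Qed.

Lemma vecnormZ m (c : R) (x : 'cV[R[i]]_m) : 0 <= c -> vecnorm (c%:C *: x) = c * vecnorm x.
Proof.
move=> c0; rewrite /vecnorm.
have -> : \sum_i Normc.normc ((c%:C *: x) i 0) ^+ 2 =
    c ^+ 2 * \sum_i Normc.normc (x i 0) ^+ 2.
  rewrite mulr_sumr; apply: eq_bigr => i _; rewrite mxE Normc.normcM exprMn.
  by rewrite /= expr0n addr0 sqr_sqrtr ?sqr_ge0.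
by rewrite sqrtrM ?sqr_ge0// sqrtr_sqr ger0_norm.
Qed.

Lemma vecnorm_mulmx_le m (A : 'M[Rcx]_m) (c : R) (x : 'cV[Rcx]_m) : posdef A -> 0 <= c ->
  (vecnorm (A *m x) <= c * vecnorm x) = (qform (mpow A 2) x <= qform (rc Rcx (c ^+ 2))%:M x).
Proof.
move=> pA c0; rewrite -ler_sqr ?nnegrE ?mulr_ge0 ?vecnorm_ge0// exprMn -(@le_rc R Rcx).
rewrite (rmorphM (rc Rcx) (c ^+ 2)) !vecnorm_qform -(scalemx1 _ (rc Rcx (c ^+ 2))) qformZ.
by rewrite -qform_congr (posdef_adj pA) mulmx1 -{1 2}(mpow1 pA) (mpowD pA).
Qed.

(** Squared, the norm inequality says A^2 <= c^2; monotonicity of the square root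
    on positive definite matrices gives back A <= c. *)
Lemma lemx_vecnorm m (A : 'M[Rcx]_m) (c : R) : posdef A -> 0 <= c ->
  A <=L (rc Rcx c)%:M <-> forall x : 'cV[R[i]]_m, vecnorm (A *m x) <= c * vecnorm x.
Proof.
move=> pA c0; split=> [Ac x|H].
  rewrite vecnorm_mulmx_le//; have := mpow_le_scalar pA (ler0n R 2) Ac.
  by rewrite powR_mulrn//; apply.
have A2 : mpow A 2 <=L (rc Rcx (c ^+ 2))%:M by move=> x; rewrite -vecnorm_mulmx_le.
have h0 : 0 <= (2 : R)^-1 by rewrite invr_ge0.
have cE : powR (c ^+ 2) 2^-1 = c.
  by rewrite powR12_sqrt ?sqr_ge0// sqrtr_sqr ger0_norm.
have AE : mpow (mpow A 2) 2^-1 = A.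
  by rewrite (mpowM pA) divff ?pnatr_eq0// (mpow1 pA).
have := mpow_le_scalar (posdef_mpow pA 2) h0 A2; rewrite AE cE.
exact: id.
Qed.

(** What the theorem needs to know of the operator norm: for a positive definite A it
    is the largest eigenvalue, hence the least scalar above A.  That A <= |A| follows
    from [lemx_vecnorm], so no eigenvector is exhibited. *)
Lemma opnorm_max_eigenvalue m (A : 'M[R[i]]_m) : (0 < m)%N -> posdefmx A ->
  [/\ 0 < opnorm A, @lemx R Rcx m A (rc Rcx (opnorm A))%:M &
    forall d, @lemx R Rcx m A (rc Rcx d)%:M -> opnorm A <= d].
Proof.
move=> m0 /posdefmxE pA; have [c [c0 Ac cmin]] := posdef_max_eigenvalue pA m0.
have vec0 : vecnorm (0 : 'cV[R[i]]_m) = 0.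
  by rewrite /vecnorm big1 ?sqrtr0// => i _; rewrite mxE Normc.normc0 expr0n.
set S := [set vecnorm (A *m x) | x in [set x : 'cV[R[i]]_m | vecnorm x <= 1]]%classic.
have S0 : (S !=set0)%classic by exists (vecnorm (A *m 0)), 0 => //=; rewrite vec0.
have leS d : 0 <= d -> @lemx R Rcx m A (rc Rcx d)%:M -> ubound S d.
  move=> d0 Ad _ [x /= x1 <-]; apply: le_trans ((lemx_vecnorm pA d0).1 Ad x) _.
  by rewrite ler_piMr.
have Sle : @lemx R Rcx m A (rc Rcx (opnorm A))%:M.
  have supS : has_sup S by split=> //; exists c; apply: leS => //; exact: ltW.
  have o0 : 0 <= opnorm A.
    apply: le_trans (vecnorm_ge0 (A *m 0)) _; apply: sup_upper_bound => //.
    by exists 0 => //=; rewrite vec0.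
  apply/lemx_vecnorm => // x.
  have [x0|x0] := eqVneq (vecnorm x) 0.
    have xE : x = 0.
      have := vecnorm_qform x; rewrite x0 expr0n rmorph0 => q0.
      apply/eqP; apply: contraT => xn; have [_ /(_ x xn)] := @posdef1 R Rcx m.
      by rewrite -q0 ltxx.
    by rewrite xE mulmx0 vec0 mulr0.
  have vx0 : 0 < vecnorm x by rewrite lt_neqAle eq_sym x0 vecnorm_ge0.
  pose y := (vecnorm x)^-1%:C *: x.
  have y1 : vecnorm y = 1 by rewrite vecnormZ ?invr_ge0 ?vecnorm_ge0// mulVf.
  have xE : x = (vecnorm x)%:C *: y.
    by rewrite scalerA -rmorphM divff// rmorph1 scale1r.
  have Ay : vecnorm (A *m y) <= opnorm A.
    by apply: sup_upper_bound => //; exists y => //=; rewrite y1.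
  by rewrite {1}xE -scalemxAr vecnormZ ?vecnorm_ge0// mulrC ler_pM2r.
have cO : c <= opnorm A by exact: cmin.
split=> //; first exact: lt_le_trans cO.
move=> d Ad; have d0 : 0 <= d by apply: le_trans (ltW c0) (cmin _ Ad).
by apply: ge_sup => //; exact: leS.
Qed.

End ComplexMatrices.

Lemma geomeanE (R : realType) m r (X A : 'M[R[i]]_m) : geomean r X A = @geo R Rcx m r X A.
Proof. by rewrite /geomean /geo !mxpowRE. Qed.

Lemma quasi_meanE (R : realType) m n r w (A : 'I_n -> 'M[R[i]]_m) :
  quasi_mean r w A = @mpow R Rcx m (\sum_j rc Rcx (w j) *: @mpow R Rcx m (A j) r) r^-1.
Proof.
rewrite /quasi_mean mxpowRE; have E j : mxpowR (A j) r = @mpow R Rcx m (A j) r.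
  exact: mxpowRE.
by under eq_bigr => j _ do rewrite E.
Qed.

Lemma renyi_objectiveE (R : realType) m n t z w (A : 'I_n -> 'M[R[i]]_m) X :
  renyi_objective t z w A X = @renyi_obj R Rcx m n w A t z X.
Proof.
rewrite /renyi_objective /renyi_obj; apply: eq_bigr => j _.
by rewrite /renyi_div /renyi_core !mxpowRE.
Qed.

Theorem theorem4p4 (R : realType) (m n : nat) (hm : (1 <= m)%N) (hn : (1 <= n)%N)
    (A : 'I_n -> 'M[R[i]]_m) (hA : forall j, posdefmx (A j))
    (w : 'I_n -> R) (hw : prob_vector w)
    (t z : R) (ht : 0 < t) (htz : t <= z) (hz : z < 1)
    (P : 'M[R[i]]_m) (hP : is_power_mean (1 - t) w A P)
    (Omega : 'M[R[i]]_m) (hOmega : is_renyi_right_mean t z w A Omega) :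
  [/\ opnorm P <= opnorm Omega,
      opnorm Omega <= opnorm (quasi_mean ((1 - t) / z) w A) &
      opnorm (quasi_mean ((t - 1) / z) w A) <= opnorm Omega].
Proof.
have [w0 w1] := hw; have [pX Xmin] := hOmega; have [pP fP] := hP.
have z0 : 0 < z by exact: lt_le_trans htz.
pose s := t / z; pose p := (1 - t) / z.
have s0 : 0 < s by rewrite divr_gt0.
have s1 : s <= 1 by rewrite ler_pdivrMr// mul1r.
have p0 : 0 < p by rewrite divr_gt0// subr_gt0 (le_lt_trans htz).
have pz : p * z = 1 - t by rewrite divfK// gt_eqF.
have spz : (s + p) * z = 1 by rewrite mulrDl pz divfK ?gt_eqF// addrC subrK.
have pA' j : @posdef R Rcx m (A j) := (posdefmxE (A j)).1 (hA j).
have pX' : @posdef R Rcx m Omega := (posdefmxE Omega).1 pX.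
have pP' : @posdef R Rcx m P := (posdefmxE P).1 pP.
have fX : @renyi_fixed R Rcx m n w z s p A Omega.
  apply: (renyi_min_fixed hm w0 w1 pA' pX' ht htz hz) => Y pY.
  by rewrite -!renyi_objectiveE; exact: Xmin ((posdefmxE Y).2 pY).
have fP' : P = \sum_j rc Rcx (w j) *: @geo R Rcx m (p * z) P (A j).
  by rewrite pz {1}fP; apply: eq_bigr => j _; rewrite geomeanE.
have [l0 Xl lmin] := opnorm_max_eigenvalue hm pX.
have [_ _ Pmin] := opnorm_max_eigenvalue hm pP.
have pQ r : @posdef R Rcx m (\sum_j rc Rcx (w j) *: @mpow R Rcx m (A j) r).
  exact: (posdef_sum hn w0 (fun j => posdef_mpow (pA' j) r)).
have pQm r : posdefmx (quasi_mean r w A).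
  by rewrite quasi_meanE; exact: (posdefmxE _).2 (posdef_mpow (pQ r) _).
have [q0 Qq _] := opnorm_max_eigenvalue hm (pQm p).
have [_ _ Qmin] := opnorm_max_eigenvalue hm (pQm (- p)).
split.
- apply: Pmin; exact: (power_mean_le_renyi hm w0 z0 hz s0 s1 p0 spz pA' pX' pP' fX fP' l0 Xl).
- rewrite quasi_meanE in q0 Qq *.
  exact: (renyi_le_quasi_mean hn w0 w1 z0 hz s0 p0 spz pA' pX' fX l0 q0 Xl lmin Qq).
- have -> : (t - 1) / z = - p by rewrite /p -mulNr opprB.
  apply: Qmin; rewrite quasi_meanE invrN.
  exact: (quasi_mean_le_renyi hn w0 w1 z0 hz s0 s1 p0 spz pA' pX' fX l0 Xl).
Qed.
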